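(* Let $\mathcal P_{F_r}:=\langle x_1,\dots,x_r\mid\ \rangle$ $(r\ge2)$ and $$\mathcal P_{\Sigma_g}:=\Bigl\langle a_1,b_1,\dots,a_g,b_g\ \Big|\ \prod_{i=1}^g[a_i,b_i]\Bigr\rangle\qquad(g\ge2).$$ Both presentations lie in the linear Dehn class, but $$\Lambda^\ast_{\mathcal P_{F_r}}(n)=+\infty\ \text{ for all } n\ge1,\qquad\text{while}\qquad\Lambda^\ast_{\mathcal P_{\Sigma_g}}(n)\asymp1.$$
   Context: A disk diagram $\Delta$ is a finite, connected, simply connected planar $2$-complex; $F(\Delta)$ is its set of faces, $\partial\Delta$ its boundary walk, $|\partial f|$ the boundary length of a face. A van Kampen diagram over a presentation $\mathcal P$ for a word $w$ is a labelled disk diagram whose faces read cyclic conjugates of relators or inverses and whose boundary walk reads $w$; area is the number of faces; $\operatorname{Area}^{\min}_{\mathcal P}(w)$ is the minimal area and a diagram attaining it is area-minimising. $\delta_{\mathcal P}(n)=\max\{\operatorname{Area}^{\min}_{\mathcal P}(w):w=_{G(\mathcal P)}1,|w|\le n,w\text{ cyclically reduced}\}$. For distinct faces, $m(f,f')$ is the number of shared edges; $b(f)$ is the number of edge occurrences on $\partial f$ lying on $\partial\Delta$; $$\mu_1(\Delta)=\inf_{g\not\equiv0}\frac{\sum_{\{f,f'\}}m(f,f')(g(f)-g(f'))^2+\sum_fb(f)g(f)^2}{\sum_f|\partial f|g(f)^2},\quad g:F(\Delta)\to\mathbb R$$ (first sum over unordered pairs of distinct faces), $\mu_1(\Delta)=+\infty$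 if $F(\Delta)=\varnothing$. $\Lambda^\ast_{\mathcal P}(n)$ is the infimum of $\mu_1(\Delta)$ over area-minimising diagrams for cyclically reduced null-homotopic words with $|\partial\Delta|\le n$. Linear Dehn class: write $f\preceq_{\mathrm D}g$ if there is $C\ge1$ with $f(n)\le Cg(Cn+C)+Cn+C$ for all $n$; $\mathcal P$ lies in the linear Dehn class if $\delta_{\mathcal P}\preceq_{\mathrm D}n$ and $n\preceq_{\mathrm D}\delta_{\mathcal P}$. For nonincreasing $f,g:\mathbb N\to[0,\infty]$, $f\preceq g$ means there is $C\ge1$ with $f(\lceil Cn\rceil)\le Cg(n)$ for all $n\ge1$, and $f\asymp g$ means $f\preceq g$ and $g\preceq f$. Here $[a,b]=aba^{-1}b^{-1}$. *)

(* Defs.v *)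
From HB Require Import structures.
From mathcomp Require Import all_boot all_order all_algebra all_fingroup.
From mathcomp Require Import all_classical all_reals all_analysis.
Set Implicit Arguments.
Unset Strict Implicit.
Unset Printing Implicit Defensive.
Import Order.TTheory GRing.Theory Num.Theory.
Local Open Scope ring_scope.

(* ** Words and presentations *)

Record presentation := Presentation {
  gen : finType;
  relators : seq (seq (gen * bool)) }.

(* The letter (x, false) is the generator x, and (x, true) its inverse. *)
Definition letter (P : presentation) : Type := (gen P * bool)%type.
Definition word (P : presentation) : Type := seq (gen P * bool).

Definition linv (S : Type) (x : S * bool) : S * bool := (x.1, ~~ x.2).
Definition winv (S : Type) (w : seq (S * bool)) : seq (S * bool) :=
  rev (map (@linv S) w).
Definition wcomm (S : Type) (u v : seq (S * bool)) : seq (S * bool) :=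
  u ++ v ++ winv u ++ winv v.

Inductive group_eq (P : presentation) : word P -> word P -> Prop :=
| group_eq_refl u : group_eq u u
| group_eq_sym u v : group_eq u v -> group_eq v u
| group_eq_trans u v w : group_eq u v -> group_eq v w -> group_eq u w
| group_eq_cancel u x v : group_eq (u ++ [:: x; linv x] ++ v) (u ++ v)
| group_eq_relator u r v :
    r \in relators P -> group_eq (u ++ r ++ v) (u ++ v).

Definition null_homotopic (P : presentation) (w : word P) : Prop :=
  group_eq w [::].

Definition cyclically_reduced (P : presentation) (w : word P) : bool :=
  path.cycle (fun x y : gen P * bool => y != linv x) w.

(* ** Disk diagrams

   A finite connected planar 2-complex is simply connected exactly when its
   complement in the sphere is a single open disk.  A disk diagram is therefore
   a cell decomposition of the sphere with one 2-cell, the outer one, removed,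
   and is encoded as a combinatorial map.  A dart is an oriented edge; [drev]
   reverses it; [dnext d] follows d on the boundary of the 2-cell lying to the
   left of d.  Since drev d ends where d starts, dnext (drev d) starts at the
   same vertex as d.  Hence edges, vertices and 2-cells of the sphere are the
   orbits of drev, of drev * dnext (first drev, then dnext) and of dnext, and
   Euler's formula says that the surface is the sphere.
   [base] is the first dart of the boundary walk.  The complex reduced to one
   vertex has no dart, and base = None in that case only. *)
Record disk_diagram := DiskDiagram {
  dart : finType;
  drev : {perm dart};
  dnext : {perm dart};
  base : option dart;
  drevK : involutive drev;
  drev_neq : forall d, drev d != d;
  dart_connected :
    forall d d', connect (fun x y => (y == drev x) || (y == dnext x)) d d';
  dart_planar : (0 < #|dart|)%N ->
    (#|porbits (drev * dnext)%g| + #|porbits dnext| = #|porbits drev| + 2)%N;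
  base_dart : isSome base = (0 < #|dart|)%N }.

Definition outer_cell (D : disk_diagram) : {set dart D} :=
  if base D is Some d then porbit (dnext D) d else finset.set0.

Definition faces (D : disk_diagram) : {set {set dart D}} :=
  porbits (dnext D) :\ outer_cell D.

Definition area (D : disk_diagram) : nat := #|faces D|.

(* The boundary walk runs through the darts of the outer cell. *)
Definition boundary_walk (D : disk_diagram) : seq (dart D) :=
  if base D is Some d then fingraph.orbit (dnext D) d else [::].

Definition perimeter (D : disk_diagram) : nat := size (boundary_walk D).

(* A face is the set of its darts, so |∂f| is #|f|; an edge met twice by ∂f
   contributes its two darts. *)
Definition shared_edges (D : disk_diagram) (f f' : {set dart D}) : nat :=
  #|[set d in f | drev D d \in f']|.

Definition boundary_edges (D : disk_diagram) (f : {set dart D}) : nat :=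
  #|[set d in f | drev D d \in outer_cell D]|.

Definition reads_relator (P : presentation) (u : word P) : Prop :=
  exists r, r \in relators P /\
  exists k : nat, u = rot k r \/ u = rot k (winv r).

Definition van_kampen (P : presentation) (w : word P) (D : disk_diagram) :
    Prop :=
  exists lab : dart D -> letter P,
    [/\ forall d, lab (drev D d) = linv (lab d),
        forall d, d \notin outer_cell D ->
          reads_relator (map lab (fingraph.orbit (dnext D) d))
      & map lab (boundary_walk D) = w].

(* ** Area, Dehn function and spectral profile *)

Section Invariants.
Variable R : realType.
Local Open Scope classical_set_scope.
Local Open Scope ereal_scope.

Definition area_min (P : presentation) (w : word P) : \bar R :=
  ereal_inf [set a | exists D, van_kampen w D /\ a = (area D)%:R%:E].

Definition area_minimising (P : presentation) (w : word P) (D : disk_diagram) :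
    Prop :=
  van_kampen w D /\ (area D)%:R%:E = area_min w.

(* The supremum is a maximum: the set is finite and contains the value at the
   empty word. *)
Definition dehn (P : presentation) (n : nat) : \bar R :=
  ereal_sup [set a | exists w : word P,
    [/\ null_homotopic w, cyclically_reduced w, (size w <= n)%N
      & a = area_min w]].

(* The factor 2^-1 turns the sum over ordered pairs of distinct faces into the
   sum over unordered ones. *)
Definition dirichlet (D : disk_diagram) (g : {set dart D} -> R) : R :=
  (2^-1 * (\sum_(f in faces D) \sum_(f' in faces D | f' != f)
             (shared_edges f f')%:R * (g f - g f') ^+ 2)
   + \sum_(f in faces D) (boundary_edges f)%:R * g f ^+ 2)%R.

Definition weighted_norm (D : disk_diagram) (g : {set dart D} -> R) : R :=
  (\sum_(f in faces D) #|f|%:R * g f ^+ 2)%R.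

(* Only the values of g on faces D matter; without faces the set is empty and
   its infimum is +oo. *)
Definition mu1 (D : disk_diagram) : \bar R :=
  ereal_inf [set a | exists g : {set dart D} -> R,
    (exists2 f, f \in faces D & g f != 0%R) /\
    a = (dirichlet g / weighted_norm g)%:E].

Definition Lambda_star (P : presentation) (n : nat) : \bar R :=
  ereal_inf [set a | exists (w : word P) (D : disk_diagram),
    [/\ null_homotopic w, cyclically_reduced w, area_minimising w D,
        (perimeter D <= n)%N & a = mu1 D]].

Definition dehn_le (f g : nat -> \bar R) : Prop :=
  exists2 C : nat, (1 <= C)%N &
    forall n, f n <= C%:R%:E * g (C * n + C)%N + (C * n + C)%:R%:E.

Definition linear_dehn_class (P : presentation) : Prop :=
  dehn_le (dehn P) (fun n => n%:R%:E) /\ dehn_le (fun n => n%:R%:E) (dehn P).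

Definition profile_le (f g : nat -> \bar R) : Prop :=
  exists2 C : R, (1 <= C)%R &
    forall n, (1 <= n)%N -> f `|Num.ceil (C * n%:R)|%N <= C%:E * g n.

Definition profile_asymp (f g : nat -> \bar R) : Prop :=
  profile_le f g /\ profile_le g f.

End Invariants.

(* ** The free and surface presentations *)

Definition free_presentation (r : nat) : presentation :=
  @Presentation 'I_r [::].

(* inl i stands for a_i and inr i for b_i. *)
Definition surface_presentation (g : nat) : presentation :=
  @Presentation ('I_g + 'I_g)%type
    [:: flatten [seq wcomm [:: (inl i, false)] [:: (inr i, false)]
                | i <- enum 'I_g]].

(* Main.v *)
Require Import Defs.
From HB Require Import structures.
From mathcomp Require Import all_boot all_order all_algebra all_fingroup.
From mathcomp Require Import all_classical all_reals all_analysis.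
From mathcomp Require Import fintype fingraph perm finset.
From mathcomp Require Import zify ring lra.

(** A diagram over a presentation without relators has no face.  Hence the Dehn
    function of the free presentation vanishes, and [mu1] of each of its diagrams
    is the infimum of the empty set. For the surface presentation everything
    rests on one isoperimetric inequality, [surface_isoperimetry]: in a diagram
    of minimal area, the total boundary length of any set of faces is at most
    28 times the number of edges that separate it from its complement. Applied
    to the set of all faces it bounds the area by a multiple of the perimeter
    ([minimal_area]). Applied to the level sets of a function it yields, by the
    argument of Cheeger, a lower bound for [mu1] that is uniform over all
    minimal diagrams ([cheeger]). The upper bound [mu1 <= 1] comes from the
    indicator function of one face, in a minimal diagram whose boundary word is
    the relator ([mu1_le1]).

    The isoperimetric inequality is Euler's formula.  If two adjacent faces of a
    diagram are mirror images of each other across an edge, they can be removed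
    and the hole can be zipped up ([cancel_mirror]), so a minimal diagram is
    reduced.  The relator has [4 * g >= 8] letters and never contains a subword
    of length two together with its inverse.  Therefore the faces of a reduced
    diagram have at least eight sides and its interior vertices have degree at
    least three.  As [1/8 + 1/3 < 1/2], a region with short boundary would have
    too small an Euler characteristic ([isoperimetry]).

    Diagrams are pairs of permutations, and all cutting and gluing is
    multiplication by transpositions.  That the result is again planar need not
    be seen in a picture: the genus of a map is never negative ([genus_ge0]), so
    a move that creates a face or a vertex cannot spoil planarity
    ([planar_tperm]).  Gluing may disconnect the map; [planar] therefore counts
    components, and [restrict_diagram] finally keeps the component of the base
    point.  The same surgeries prove van Kampen's lemma ([van_kampen_exists]):
    the set of boundary words of planar maps is closed under the moves that
    generate equality in the group, in both directions. *)

Set Implicit Arguments.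
Unset Strict Implicit.
Unset Printing Implicit Defensive.
Import Order.TTheory GRing.Theory Num.Theory.
Local Open Scope ring_scope.
Local Open Scope nat_scope.
Local Open Scope group_scope.

(** * Pairs of permutations and the genus inequality *)

Section Components.
Variable T : finType.
Implicit Types (e : rel T) (s t : {perm T}).

Lemma leq_n_comp e1 e2 : connect_sym e1 -> connect_sym e2 ->
  subrel e1 (connect e2) -> #|roots e2| <= #|roots e1|.
Proof.
move=> s1 s2 /connect_sub s12.
rewrite -(card_in_imset (f := root e1) (D := roots e2)).
  by apply/subset_leq_card/fintype.subsetP => _ /imsetP[x _ ->]; apply: roots_root.
move=> u v /eqP ru /eqP rv /eqP; rewrite root_connect // => /s12.
by rewrite -root_connect // ru rv => /eqP.
Qed.

(** Adding the edge from [x] to [y] to a graph merges at most two components.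
    The graphs are compared up to connectivity only, because multiplying a
    permutation by a transposition both adds and removes edges. *)
Lemma n_comp_add_edge e1 e2 x y : connect_sym e1 -> connect_sym e2 ->
  (forall u v, e2 u v -> connect e1 u v \/
     (connect e1 u x || connect e1 u y) && (connect e1 v x || connect e1 v y)) ->
  #|roots e1| <= #|roots e2|.+1.
Proof.
move=> s1 s2 h.
have h' u v : connect e2 u v -> connect e1 u v \/
     (connect e1 u x || connect e1 u y) && (connect e1 v x || connect e1 v y).
  case/connectP=> p; elim: p u => [|w p IH] u /=; first by move=> _ ->; left.
  case/andP=> /h uw /IH{}IH /IH{IH} wv.
  case: uw wv => [uw|/andP[uxy wxy]] [wv|/andP[wxy' vxy]].
  - by left; apply: connect_trans wv.
  - right; rewrite vxy andbT.
    by case/orP: wxy' => /(connect_trans uw) ->; rewrite ?orbT.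
  - right; rewrite uxy /=; rewrite s1 in wv.
    by case/orP: wxy => /(connect_trans wv) ->; rewrite ?orbT.
  - by right; rewrite uxy.
rewrite (cardD1 (root e1 x)) (roots_root s1 x : root e1 x \in roots e1) add1n ltnS.
rewrite -(card_in_imset (f := root e2) (D := [predD1 roots e1 & root e1 x])).
  by apply/subset_leq_card/fintype.subsetP => _ /imsetP[u _ ->]; apply: roots_root.
have nx u : u \in [predD1 roots e1 & root e1 x] -> ~~ connect e1 u x.
  move=> /andP[ux /eqP ru]; apply: contra ux.
  by rewrite -root_connect // ru.
move=> u v uR vR /eqP; rewrite root_connect // => /h'.
have uv : connect e1 u v -> u = v.
  move: uR vR => /andP[_ /eqP ru] /andP[_ /eqP rv].
  by rewrite -root_connect // ru rv => /eqP.
case=> [//|]; rewrite (negPf (nx _ uR)) (negPf (nx _ vR)) /=.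
by case/andP=> uy vy; apply: uv; apply: connect_trans uy _; rewrite s1.
Qed.

(** The same relation as the one that defines connectedness of a disk diagram,
    here for arbitrary permutations [s] and [t]. *)
Definition step s t : rel T := fun x y => (y == s x) || (y == t x).

Definition ncomp s t := #|roots (step s t)|.

Lemma porbit_connect s t : (forall x, step s t x (s x)) ->
  forall x y, y \in porbit s x -> connect (step s t) x y.
Proof.
move=> h x y /porbitP[i ->]; elim: i => [|i IH]; first by rewrite expg0 perm1.
by rewrite expgSr permM; apply: connect_trans IH (connect1 (h _)).
Qed.

Lemma porbit_connectl s t x y : y \in porbit s x -> connect (step s t) x y.
Proof. by apply: porbit_connect => z; rewrite /step eqxx. Qed.

Lemma porbit_connectr s t x y : y \in porbit t x -> connect (step s t) x y.
Proof.
move=> h; have := @porbit_connectl t s x y h.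
by apply: connect_sub => u v /orP h'; apply: connect1; apply/orP; case: h'; auto.
Qed.

Lemma mem_porbit_next s x : s x \in porbit s x.
Proof. by have := mem_porbit s 1 x; rewrite expg1. Qed.

Lemma porbit_closed s x u : u \in porbit s x -> s u \in porbit s x.
Proof. by rewrite -!eq_porbit_mem; have := porbit_perm s 1 u; rewrite expg1 => ->. Qed.

Lemma step_sym s t : connect_sym (step s t).
Proof.
have h u v : step s t u v -> connect (step s t) v u.
  case/orP=> /eqP->; [apply: porbit_connectl|apply: porbit_connectr];
  by rewrite porbit_sym mem_porbit_next.
have h' u v : connect (step s t) u v -> connect (step s t) v u.
  case/connectP=> p; elim: p u => [|w p IH] u /=; first by move=> _ ->.
  by case/andP=> /h uw /IH{}IH /IH{IH} wv; apply: connect_trans uw.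
by move=> u v; apply/idP/idP; apply: h'.
Qed.

Lemma porbits_tperm_split s x y : x != y -> y \in porbit s x ->
  #|porbits (tperm x y * s)| = #|porbits s|.+1.
Proof.
move=> xy; rewrite porbit_sym => yx.
by have /= := porbits_mul_tperm s x y; rewrite yx xy addn0 addn1.
Qed.

Lemma porbits_tperm_merge s x y : y \notin porbit s x ->
  #|porbits (tperm x y * s)|.+1 = #|porbits s|.
Proof.
rewrite porbit_sym => yx.
have xy : x != y by apply: contraNneq yx => ->; apply: porbit_id.
by have /= := porbits_mul_tperm s x y; rewrite yx xy /= addn1 addn2 => -[->].
Qed.

Lemma ncomp_tperm s t x y : ncomp s (tperm x y * t) <= (ncomp s t).+1.
Proof.
apply: (n_comp_add_edge (x := x) (y := y)) (step_sym _ _) (step_sym _ _) _ => u v.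
set e1 := step s (tperm x y * t)%g.
case/orP=> /eqP->; first by left; apply: porbit_connectl; exact: mem_porbit_next.
have h z : connect e1 (t (tperm x y z)) z.
  rewrite (step_sym _ _); apply: porbit_connectr.
  by have := mem_porbit_next (tperm x y * t) z; rewrite permM.
case: (eqVneq u x) => [->|ux].
  by right; rewrite connect0 /=; have := h y; rewrite tpermR => ->; rewrite orbT.
case: (eqVneq u y) => [->|uy].
  by right; rewrite connect0 orbT /=; have := h x; rewrite tpermL => ->.
by left; rewrite (step_sym _ _); have := h u; rewrite tpermD // eq_sym.
Qed.

Lemma ncomp_tperm_connected s t x y : connect (step s (tperm x y * t)) x y ->
  ncomp s (tperm x y * t) <= ncomp s t.
Proof.
set e1 := step s (tperm x y * t)%g => xy.
apply: leq_n_comp; [exact: step_sym|exact: step_sym|] => u v.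
case/orP=> /eqP->; first by apply: porbit_connectl; exact: mem_porbit_next.
have h z : connect e1 z (t (tperm x y z)).
  by apply: porbit_connectr; have := mem_porbit_next (tperm x y * t) z; rewrite permM.
case: (eqVneq u x) => [->|ux].
  by apply: connect_trans xy _; have := h y; rewrite tpermR.
case: (eqVneq u y) => [->|uy].
  by rewrite (step_sym _ _) in xy; apply: connect_trans xy _; have := h x; rewrite tpermL.
by have := h u; rewrite tpermD // eq_sym.
Qed.

Lemma connect_invariant e (P : pred T) x y :
  (forall u v, e u v -> P u -> P v) -> connect e x y -> P x -> P y.
Proof.
move=> h /connectP[p + ->]; elim: p x => [|z p IH] x //= /andP[/h xz /IH{}IH] /xz.
exact: IH.
Qed.

Lemma porbit_connectM s t x y : y \in porbit (s * t) x -> connect (step s t) x y.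
Proof.
move=> h; apply: connect_invariant (@porbit_connectl (s * t) 1 _ _ h) (connect0 _ _).
move=> u v; rewrite /step perm1 => /orP[]/eqP-> // /connect_trans-> //.
apply: (@connect_trans _ _ (s u)); first by apply: porbit_connectl; exact: mem_porbit_next.
by rewrite permM; apply: porbit_connectr; exact: mem_porbit_next.
Qed.

Lemma connect_permV s t x : connect (step s t) (s^-1 x) x.
Proof. by apply: porbit_connectl; have := mem_porbit_next s (s^-1 x); rewrite permKV. Qed.

Lemma mul_tperm s t x y :
  s * (tperm x y * t) = tperm (s^-1 x) (s^-1 y) * (s * t).
Proof. by rewrite -tpermJ /conjg invgK !mulgA mulgKV. Qed.

Lemma porbits1 : #|porbits (1 : {perm T})| = #|T|.
Proof.
rewrite card_imset // => x y /setP/(_ x); rewrite porbit_id => /esym.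
by case/porbitP => i ->; rewrite expg1n perm1.
Qed.

(** Nonnegativity of the genus.  Write [t] as a transposition times [t'], where
    [t'] has one cycle more than [t].  If [s * t] has also one cycle less than
    [s * t'], then the left-hand side drops by two from [t'] to [t], and a
    transposition joins at most two components.  Otherwise the left-hand side
    is the same for both, and so is the number of components, because the two
    points lie on one cycle of [s * t']. *)
Theorem genus_ge0 s t :
  #|porbits s| + #|porbits t| + #|porbits (s * t)| <= #|T| + (ncomp s t).*2.
Proof.
have [k] := ubnP (#|T| - #|porbits t|); elim: k t => // k IH t.
have lt (u : {perm T}) : #|porbits u| <= #|T| by apply: (@leq_trans #|T|%N); [exact: leq_imset_card|].
have [/eqP ->|] := boolP (t == 1%g).
  move=> _; rewrite mulg1 porbits1 addnAC addnC leq_add2l -addnn.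
  suff h : #|porbits s| <= ncomp s 1 by rewrite leq_add.
  apply: (@leq_trans #|[set porbit s x | x in roots (step s 1)]|); last first.
    exact: leq_imset_card.
  apply/subset_leq_card.
  apply/fintype.subsetP => _ /imsetP[x _ ->].
  apply/imsetP; exists (root (step s 1) x); first exact/roots_root/step_sym.
  apply/eqP; rewrite eq_porbit_mem porbit_sym.
  apply: connect_invariant (connect_root (step s 1) x) (porbit_id _ _) => u v.
  by rewrite /step perm1 => /orP[]/eqP-> //; apply: porbit_closed.
move=> t1; have [x xtx] : exists x, x != t x.
  apply/existsP; apply: contraNT t1 => /existsPn h; apply/eqP/permP => x.
  by rewrite perm1; apply/eqP; rewrite eq_sym; have := h x; rewrite negbK.
rewrite ltnS => le.
set t' := tperm x (t x) * t.
have := porbits_tperm_split xtx (mem_porbit_next t x); rewrite -/t' => E'.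
have tE : t = tperm x (t x) * t' by rewrite /t' mulgA tperm2 mul1g.
have {}IH : #|porbits s| + #|porbits t'| + #|porbits (s * t')| <= #|T| + (ncomp s t').*2.
  by apply: IH; rewrite E' -ltnS; move: (lt t'); rewrite E'; lia.
have C1 : ncomp s t' <= (ncomp s t).+1 by exact: ncomp_tperm.
set a := s^-1 x; set b := s^-1 (t x).
have st : s * t = tperm a b * (s * t') by rewrite -mul_tperm -tE.
have ab : a != b by rewrite (inj_eq perm_inj).
have [ba|nba] := boolP (b \in porbit (s * t') a); last first.
  by have := porbits_tperm_merge nba; rewrite -st; lia.
have := porbits_tperm_split ab ba; rewrite -st.
suff : ncomp s t' <= ncomp s t by lia.
apply: ncomp_tperm_connected; rewrite -/t'.
apply: connect_trans (connect_permV _ _ (t x)); rewrite (step_sym _ _).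
apply: connect_trans (connect_permV _ _ x); rewrite -/a -/b (step_sym _ _).
exact: porbit_connectM.
Qed.
End Components.

(** * Planar maps *)

Section Planar.
Variable T : finType.
Implicit Types (e n s t : {perm T}).

(** When [e] is the edge reversal of a map, this says that every component is a
    sphere: [genus_ge0] bounds the contribution of each component to the
    difference of the two sides. *)
Definition planar e n :=
  #|porbits e| + (ncomp e n).*2 <= #|porbits n| + #|porbits (e * n)|.

Lemma porbit_tperm_merge s x y : y \notin porbit s x -> y \in porbit (tperm x y * s) x.
Proof.
move=> yx; have := porbits_tperm_merge yx.
apply: contra_eqT => /porbits_tperm_merge; rewrite mulgA tperm2 mul1g => <-.
by rewrite neq_ltn !ltnS leqnSn ?orbT.
Qed.

(** Every surgery on maps below is a product of such moves.  Exchanging the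
    successors of two darts of one face cuts this face in two; this either
    identifies two vertices, or splits a vertex, in which case nonnegativity of
    the genus forces a component to split as well.  Dually for the darts that
    meet at one vertex. *)
Lemma planar_tperm e n x y :
  y \in porbit n x \/ e^-1 y \in porbit (e * n) (e^-1 x) ->
  planar e n -> planar e (tperm x y * n).
Proof.
rewrite /planar mul_tperm.
have [->|xy] := eqVneq x y; first by rewrite !tperm1 !mul1g.
set a := e^-1 x; set b := e^-1 y; set n' := tperm x y * n.
have ab : a != b by rewrite (inj_eq perm_inj).
have C1 : ncomp e n' <= (ncomp e n).+1 by exact: ncomp_tperm.
have [yx _|nyx] := boolP (y \in porbit n x).
  have Fn : #|porbits n'| = #|porbits n|.+1 := porbits_tperm_split xy yx.
  have [ba|nba] := boolP (b \in porbit (e * n) a).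
    by have := porbits_tperm_split ab ba; lia.
  have := porbits_tperm_merge nba.
  suff : ncomp e n' <= ncomp e n by lia.
  apply: ncomp_tperm_connected; rewrite -/n'.
  apply: connect_trans (connect_permV _ _ y); rewrite step_sym.
  apply: connect_trans (connect_permV _ _ x); rewrite step_sym.
  by apply: porbit_connectM; rewrite mul_tperm; apply: porbit_tperm_merge.
case=> // ba; have := porbits_tperm_split ab ba.
have : #|porbits n'|.+1 = #|porbits n| := porbits_tperm_merge nyx.
suff : ncomp e n' <= ncomp e n by lia.
apply: ncomp_tperm_connected; rewrite -/n'.
by apply: porbit_connectr; apply: porbit_tperm_merge.
Qed.

Lemma porbit_sub s (O : {set T}) x : (forall u, u \in O -> s u \in O) -> x \in O ->
  porbit s x \subset O.
Proof.
move=> h xO; apply/fintype.subsetP => _ /porbitP[i ->]; elim: i => [|i IH].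
  by rewrite expg0 perm1.
by rewrite expgSr permM h.
Qed.

(** Each point of [X] becomes an orbit of [s'], and the other points still need
    an orbit of [s'] inside each orbit of [s] that is not contained in [X]. *)
Lemma porbits_refine s s' (X : {set T}) :
  (forall u, s' u \in porbit s u) -> (forall u, u \in X -> s' u = u) ->
  #|[set O in porbits s | ~~ (O \subset X)]| + #|X| <= #|porbits s'|.
Proof.
move=> h fX; pose B := [set [set x] | x in X].
have s1 x : x \in X -> porbit s' x = [set x].
  move=> xX; apply/eqP; rewrite eqEsubset sub1set porbit_id andbT.
  by apply: porbit_sub; [move=> u /set1P->; rewrite fX // set11|rewrite set11].
have sB : B \subset porbits s'.
  by apply/fintype.subsetP => _ /imsetP[x /s1<- ->]; apply: imset_f.
rewrite -(cardsID B (porbits s')) addnC leq_add //.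
  by rewrite (setIidPr sB) card_imset //; exact: set1_inj.
pose f (Q : {set T}) := \bigcup_(x in Q) porbit s x.
apply: leq_trans (leq_imset_card f _); apply/subset_leq_card.
apply/fintype.subsetP => O; rewrite inE => /andP[/imsetP[x0 _ ->]] /subsetPn[x xx0 xX].
apply/imsetP; exists (porbit s' x).
  rewrite inE imset_f // andbT; apply: contra xX => /imsetP[z zX /setP/(_ x)].
  by rewrite porbit_id inE => /esym/eqP->.
have /eqP-> : porbit s x0 == porbit s x by rewrite eq_porbit_mem porbit_sym.
have sO : porbit s' x \subset porbit s x.
  apply: porbit_sub (porbit_id _ _) => u.
  rewrite -eq_porbit_mem => /eqP<-; exact: h.
apply/eqP; rewrite eqEsubset; apply/andP; split.
  by rewrite /f (bigcup_sup x) // porbit_id.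
apply/bigcupsP => z /(fintype.subsetP sO).
by rewrite -eq_porbit_mem => /eqP->.
Qed.

Lemma partition_porbits s : partition (porbits s) [set: T].
Proof.
apply/and3P; split.
- apply/eqP/setP => x; rewrite inE; apply/bigcupP; exists (porbit s x); rewrite ?porbit_id //.
  exact: imset_f.
- apply/trivIsetP => _ _ /imsetP[x _ ->] /imsetP[y _ ->]; apply: contraR.
  case/pred0Pn => z /andP[/= zx zy]; rewrite -eq_porbit_mem in zx.
  by rewrite -(eqP zx) eq_porbit_mem.
- by apply/imsetP => -[x _ /setP/(_ x)]; rewrite porbit_id inE.
Qed.

Lemma leq_card_porbits s (X : {set T}) k :
  (forall x, porbit s x \subset X -> k <= #|porbit s x|) ->
  #|[set O in porbits s | O \subset X]| * k <= #|X|.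
Proof.
move=> h; have /and3P[_ tI _] := partition_porbits s.
set Q := [set O in porbits s | _].
have tQ : trivIset Q by apply: trivIsetS tI; apply/fintype.subsetP => O; rewrite inE => /andP[].
apply: (@leq_trans #|cover Q|); last first.
  by apply/subset_leq_card/bigcupsP => O; rewrite inE => /andP[].
move: tQ => /eqP <-; rewrite -sum_nat_const; apply: leq_sum => O.
by rewrite inE => /andP[/imsetP[x _ ->]]; exact: h.
Qed.

Definition edge_perm e := involutive e /\ forall x, e x != x.

Lemma card_edge_perm e : edge_perm e -> (#|porbits e|).*2 = #|T|.
Proof.
case=> eK ne.
have E x : porbit e x = [set x; e x].
  apply/eqP; rewrite eqEsubset; apply/andP; split.
    apply: porbit_sub; last by rewrite !inE eqxx.
    by move=> u; rewrite !inE => /orP[]/eqP->; rewrite ?eK eqxx ?orbT.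
  by rewrite subUset !sub1set porbit_id mem_porbit_next.
rewrite -muln2 -cardsT.
rewrite (@card_uniform_partition _ 2 (porbits e) [set: T]) ?muln2 //.
  by move=> _ /imsetP[x _ ->]; rewrite E cards2 eq_sym ne.
exact: partition_porbits.
Qed.

Lemma edge_permV e : edge_perm e -> e^-1 = e.
Proof. by case=> eK _; apply/permP => x; apply: (@perm_inj _ e); rewrite permKV eK. Qed.
End Planar.

(** * Splitting and zipping faces *)

Lemma linvK (S : Type) : involutive (@linv S).
Proof. by case=> x b; rewrite /linv /= negbK. Qed.

Lemma map_orbit (T T' : finType) (s : {perm T}) (s' : {perm T'}) (f : T -> T') d :
  injective f -> (forall u, u \in fingraph.orbit s d -> s' (f u) = f (s u)) ->
  fingraph.orbit s' (f d) = map f (fingraph.orbit s d).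
Proof.
move=> fI h; have cc : fcycle s' (map f (fingraph.orbit s d)).
  rewrite cycle_map.
  apply: (sub_in_cycle (P := mem (fingraph.orbit s d))) (cycle_orbit (@perm_inj _ s) d).
    by move=> u v ud _ /eqP <- /=; rewrite h.
  exact/allP.
rewrite (fingraph.orbitE cc) ?(map_inj_uniq fI) ?orbit_uniq ?map_f ?in_orbit //.
rewrite /fingraph.orbit /fingraph.order.
by case: #|_| (in_orbit s d) => [|k] //= _; rewrite eqxx rot0.
Qed.

Lemma cycle_next (T : finType) (L : Type) (n : {perm T}) (lab : T -> L) (q : rel L) c d :
  fcycle n c -> d \in c -> path.cycle q (map lab c) -> q (lab d) (lab (n d)).
Proof.
move=> cc dc; rewrite cycle_map => /next_cycle/(_ dc) /=.
by have := next_cycle cc dc => /eqP <-.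
Qed.

Section Surgery.
Variables (T : finType) (L : Type) (lab : T -> L * bool).
Implicit Types (e n : {perm T}).

Definition label_compat e := forall d, lab (e d) = linv (lab d).

Lemma mem_orbit_porbit n x y : (y \in fingraph.orbit n x) = (y \in porbit n x).
Proof.
rewrite -fconnect_orbit; apply/idP/porbitP => [h|[i ->]].
  by exists (findex n x y); rewrite permX iter_findex.
by rewrite permX fconnect_iter.
Qed.

Lemma cycle_porbit n c x y : fcycle n c -> x \in c -> y \in c -> y \in porbit n x.
Proof. by move=> cc xc yc; rewrite -mem_orbit_porbit (in_orbit_cycle cc). Qed.

(** Geometrically, the starting points of the two arcs are identified across
    the face, which becomes two faces. *)
Lemma split_cycle n x1 p1 x2 p2 (n1 := tperm (last x1 p1) (last x2 p2) * n) :
  fcycle n ((x1 :: p1) ++ (x2 :: p2)) -> uniq ((x1 :: p1) ++ (x2 :: p2)) ->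
  [/\ fcycle n1 (x1 :: p1), fcycle n1 (x2 :: p2),
      forall u, u \notin (x1 :: p1) ++ (x2 :: p2) -> n1 u = n u
    & last x2 p2 \in porbit n (last x1 p1)].
Proof.
set l1 := last x1 p1 in n1 *; set l2 := last x2 p2 in n1 *.
set c := _ ++ _ => cc; have l1c : l1 \in c by rewrite mem_cat mem_last.
have l2c : l2 \in c by rewrite mem_cat mem_last orbT.
rewrite cat_uniq => /and3P[_ /hasPn dis _].
have dis' u : u \in x1 :: p1 -> u \notin x2 :: p2.
  by move=> u1; apply/negP => /dis/negP.
move: (cc); rewrite /c /= rcons_cat /= cat_path /= rcons_path /= -/l1 -/l2.
case/and4P => pa /eqP nl1 pb /eqP nl2.
have n1l1 : n1 l1 = x1 by rewrite permM tpermL.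
have n1l2 : n1 l2 = x2 by rewrite permM tpermR.
have n1u u : u != l1 -> u != l2 -> n1 u = n u.
  by move=> u1 u2; rewrite permM tpermD // eq_sym.
split.
- rewrite /= rcons_path -/l1 /= n1l1 eqxx andbT.
  apply: (sub_in_path (P := mem (x1 :: p1))) pa; last exact/allP.
  move=> u v ux vx /eqP nu; apply/eqP; rewrite n1u //.
    by apply/eqP => ul; have := dis' _ vx; rewrite -nu ul nl1 mem_head.
  by apply/eqP => ul; have := dis' _ ux; rewrite ul mem_last.
- rewrite /= rcons_path -/l2 /= n1l2 eqxx andbT.
  apply: (sub_in_path (P := mem (x2 :: p2))) pb; last exact/allP.
  move=> u v ux vx /eqP nu; apply/eqP; rewrite n1u //.
    by apply/eqP => ul; have := dis _ ux; rewrite /= ul mem_last.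
  by apply/eqP => ul; have := dis _ vx; rewrite /= -nu ul nl2 mem_head.
- move=> u uc; rewrite n1u //; apply: contraNneq uc => -> //.
- exact: cycle_porbit cc l1c l2c.
Qed.

Lemma porbit_tperm n x y u : y \in porbit n x -> (tperm x y * n) u \in porbit n u.
Proof.
move=> yx; rewrite permM; case: tpermP => [->|->|_ _]; last exact: mem_porbit_next.
  exact: porbit_closed.
by apply: porbit_closed; rewrite porbit_sym.
Qed.

(** Gluing the two sides of a bigon.  The edges [{y, z}] and [{y', z'}] become
    the edge [{z, z'}], and the two leftover darts are paired into a component
    of their own instead of being erased: the set of darts and the faces stay
    the same during the surgeries, and the debris goes away when the map is
    restricted to the component of its base point. *)
Lemma close_bigon e n y y' : edge_perm e -> planar e n -> label_compat e ->
  n y = y' -> n y' = y -> y != y' -> lab y' = linv (lab y) ->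
  exists e', [/\ edge_perm e', planar e' n, label_compat e', e' y = y'
    & forall u, u \notin [:: y; y'] -> e u \notin [:: y; y'] -> e' u = e u]
    /\ forall u, connect (step e n) u (e' u).
Proof.
move=> He pl lc ny ny' yy' ly; have [eK ne] := He.
have [ey|ey] := eqVneq (e y) y'.
  exists e; split=> // u; apply: porbit_connectl; exact: mem_porbit_next.
set z := e y in ey; set z' := e y'.
have zy : z != y by apply: ne.
have z'y' : z' != y' by apply: ne.
have z'y : z' != y by apply: contraNneq ey => h; rewrite /z -h /z' eK.
have zz' : z != z' by rewrite (inj_eq perm_inj).
have ez : e z = y by rewrite eK.
have ez' : e z' = y' by rewrite eK.
set t := tperm z y'; pose e' := t * e * t.
have ty : t y = y by rewrite /t tpermD // eq_sym.
have tz' : t z' = z' by rewrite /t tpermD // eq_sym.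
have e'E u : e' u = t (e (t u)) by rewrite !permM.
have e'y : e' y = y' by rewrite e'E ty tpermL.
have e'y' : e' y' = y by rewrite e'E tpermR ez.
have e'z : e' z = z' by rewrite e'E tpermL.
have e'z' : e' z' = z by rewrite e'E tz' ez' tpermR.
have e'o u : u \notin [:: y; y'] -> e u \notin [:: y; y'] -> e' u = e u.
  rewrite !inE !negb_or => /andP[uy uy'] /andP[euy euy'].
  have uz : u != z by apply: contraNneq euy => ->; rewrite ez.
  rewrite e'E [t u]tpermD; [|by rewrite eq_sym..].
  by rewrite /t tpermD // eq_sym // (inj_eq perm_inj).
have cases u : [\/ u \in [:: y; y'], u \in [:: z; z'] | u \notin [:: y; y'] /\ e u \notin [:: y; y']].
  have [uy|uy] := boolP (u \in [:: y; y']); first by constructor 1.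
  have [uz|uz] := boolP (u \in [:: z; z']); first by constructor 2.
  constructor 3; split=> //; apply: contra uz; rewrite !inE.
  by rewrite -[u](eK) /z /z' !(inj_eq perm_inj) eK.
have He' : edge_perm e'.
  split=> u; first by rewrite !e'E tpermK eK tpermK.
  by rewrite e'E -{2}[u](tpermK z y') (inj_eq perm_inj) ne.
have cn w : connect (step e n) w (n w) by apply: porbit_connectr; exact: mem_porbit_next.
have ce w : connect (step e n) w (e w) by apply: porbit_connectl; exact: mem_porbit_next.
have cy : connect (step e n) y y' by have := cn y; rewrite ny.
have cz : connect (step e n) z z'.
  by apply: connect_trans (ce _) _; rewrite ez; apply: connect_trans cy (ce _).
exists e'; split; last first.
  move=> u; case: (cases u) => [||[h1 h2]]; last by rewrite e'o.
    rewrite !inE => /orP[]/eqP->; rewrite ?e'y ?e'y' //.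
    by rewrite step_sym.
  rewrite !inE => /orP[]/eqP->; rewrite ?e'z ?e'z' //.
  by rewrite step_sym.
clear cn ce cy cz; split => //; last first.
  move=> u; case: (cases u) => [||[h1 h2]]; last by rewrite e'o.
    by rewrite !inE => /orP[]/eqP->; rewrite ?e'y ?e'y' ly ?linvK.
  by rewrite !inE => /orP[]/eqP->; rewrite ?e'z ?e'z' /z /z' !lc ly ?linvK.
have Ee : #|porbits e'| = #|porbits e|.
  by apply: double_inj; rewrite !card_edge_perm.
(* y and y' leave their vertices and become two vertices of degree one *)
have Ve : #|porbits (e * n)| + 2 <= #|porbits (e' * n)|.
  have := @porbits_refine _ (e * n) (e' * n) [set y; y'].
  rewrite cards2 yy'.
  rewrite (_ : [set _ in _ | _] = porbits (e * n)); last first.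
    apply/setP => O; rewrite inE; case: imsetP => //= -[x _ ->].
    have [|] := boolP (x \in [set y; y']); last first.
      by move=> xX; apply/subsetPn; exists x; rewrite ?porbit_id.
    move=> xX; apply/subsetPn; exists ((e * n) x); first exact: mem_porbit_next.
    rewrite permM; move: xX; rewrite !inE => /orP[]/eqP->.
      by rewrite -/z -[X in _ == X]ny' -[X in _ || (_ == X)]ny !(inj_eq perm_inj) negb_or ey.
    by rewrite -/z' -[X in _ == X]ny' -[X in _ || (_ == X)]ny !(inj_eq perm_inj) negb_or z'y' z'y.
  apply=> [u|u]; last first.
    by rewrite permM !inE => /orP[]/eqP->; rewrite ?e'y ?e'y' ?ny ?ny'.
  rewrite permM; case: (cases u) => [||[h1 h2]]; last first.
  - by rewrite e'o // -permM mem_porbit_next.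
  - rewrite !inE => /orP[]/eqP->; rewrite ?e'z ?e'z'.
      have := mem_porbit (e * n) 2 z.
      by rewrite expgS expg1 permM [_ z]permM ez ny permM.
    have := mem_porbit (e * n) 2 z'.
    by rewrite expgS expg1 permM [_ z']permM ez' ny' permM.
  - by rewrite !inE => /orP[]/eqP->; rewrite ?e'y ?e'y' ?ny ?ny' porbit_id.
have Ce : ncomp e' n <= (ncomp e n).+1.
  apply: (n_comp_add_edge (x := y) (y := z)) (step_sym _ _) (step_sym _ _) _ => u v.
  have cn w : connect (step e' n) w (n w) by apply: porbit_connectr; exact: mem_porbit_next.
  have ce w : connect (step e' n) w (e' w) by apply: porbit_connectl; exact: mem_porbit_next.
  have cy : connect (step e' n) y' y by have := cn y'; rewrite ny'.
  have cz : connect (step e' n) z' z by have := ce z'; rewrite e'z'.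
  case/orP=> /eqP->; last by left.
  case: (cases u) => [a|b|[h1 h2]]; last by left; rewrite -e'o.
    by right; move: a; rewrite !inE => /orP[]/eqP->; rewrite -/z -/z' ?connect0 ?cy ?cz ?orbT.
  by right; move: b; rewrite !inE => /orP[]/eqP->; rewrite ?ez ?ez' ?connect0 ?cy ?cz ?orbT.
by move: pl; rewrite /planar Ee; lia.
Qed.

(** A face whose boundary reads a word followed by its inverse can be zipped
    up, starting from the two letters in the middle: splitting the face makes
    them a bigon, which is then closed.  The darts of the face are discarded,
    and the edges that bordered it from outside are glued in pairs.  The last
    clause says that the surgery does not connect different components. *)
Lemma zip_cycle e n xs ys (c := xs ++ ys) :
  edge_perm e -> planar e n -> label_compat e -> fcycle n c -> uniq c ->
  map lab ys = winv (map lab xs) ->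
  exists e' n', [/\ edge_perm e', planar e' n' & label_compat e'] /\
    [/\ forall u, u \notin c -> n' u = n u,
        forall u, u \in c -> (e' u \in c) && (n' u \in c)
      & forall u, u \notin c -> e u \notin c -> e' u = e u] /\
    forall u, connect (step e n) u (e' u) && connect (step e n) u (n' u).
Proof.
have cn (s t : {perm T}) w : connect (step s t) w (t w).
  by apply: porbit_connectr; exact: mem_porbit_next.
have ce (s t : {perm T}) w : connect (step s t) w (s w).
  by apply: porbit_connectl; exact: mem_porbit_next.
rewrite /c {c}; elim/last_ind: xs ys e n => [|xs y IH] ys e n He pl lc.
  by case: ys => // *; exists e, n; split=> //; split=> // u; rewrite ce cn.
rewrite /winv map_rcons map_rcons rev_rcons -/(winv _).
case: ys => [|y' ys] // => cc uc [ly lys].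
have [cc' uc' inc] : [/\ fcycle n ((ys ++ xs) ++ [:: y; y']),
    uniq ((ys ++ xs) ++ [:: y; y']) &
    forall u, (u \in (ys ++ xs) ++ [:: y; y']) = (u \in rcons xs y ++ y' :: ys)].
  rewrite (_ : _ ++ [:: y; y'] = rot (size (rcons xs y ++ [:: y'])) (rcons xs y ++ y' :: ys)).
    by rewrite rot_cycle rot_uniq; split=> // u; rewrite mem_rot.
  by rewrite -[y' :: ys]cat1s catA rot_size_cat -cats1 -!catA.
have yy' : y != y'.
  by apply: contraTneq uc => ->; rewrite -cats1 -catA cat_uniq /= inE eqxx !andbF.
have {lys}lys : map lab ys = winv (map lab xs) by [].
(* y and y' bound a bigon, after a split unless they already exhaust the face *)
have [n1 [[pl1 n1y n1y' cc1 n1o] n1c]] : exists n1, [/\ planar e n1, n1 y = y', n1 y' = y,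
    fcycle n1 (xs ++ ys) & forall u, u \notin rcons xs y ++ y' :: ys -> n1 u = n u]
    /\ forall u, connect (step e n) u (n1 u).
  case: (ys ++ xs) cc' uc' inc (rot_size_cat ys xs) => [|h q] cc' uc' inc rE.
    exists n; split; last exact: cn.
    case: (xs) rE; case: (ys) => //= _; split=> //.
      by case/and3P: cc' => /eqP.
    by case/and3P: cc' => _ /eqP.
  have [c1 c2 o1 o2] := split_cycle cc' uc'.
  set n1 := _ * n in c1 c2 o1; exists n1; split; last first.
    move=> u; apply: porbit_connectr; exact: porbit_tperm.
  split.
  - by apply: planar_tperm => //; left.
  - by case/and3P: c2 => /eqP.
  - by case/and3P: c2 => _ /eqP.
  - by rewrite -rE rot_cycle.
  - by move=> u uc1; apply: o1; rewrite inc.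
have nq u : u \in xs ++ ys -> u \notin [:: y; y'].
  move: uc'; rewrite cat_uniq => /and3P[_ /hasPn h _] uq; apply/negP => /h /=.
  by rewrite mem_cat orbC -mem_cat uq.
have uq : uniq (xs ++ ys).
  by move: uc'; rewrite cat_uniq uniq_catC => /and3P[].
have [e1 [[He1 ple1 lc1 e1y e1o] e1c]] := close_bigon He pl1 lc n1y n1y' yy' ly.
have e1y' : e1 y' = y by rewrite -e1y; case: He1.
have [e' [n' [[He' pl' lc'] [[h1 h2 h3] h4]]]] := IH ys e1 n1 He1 ple1 lc1 cc1 uq lys.
have inc' u : (u \in rcons xs y ++ y' :: ys) = (u \in [:: y; y']) || (u \in xs ++ ys).
  by rewrite -inc mem_cat orbC; congr (_ || _); rewrite !mem_cat orbC.
exists e', n'; split=> //; split; last first.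
  have sub1 u v : connect (step e n1) u v -> connect (step e n) u v.
    by apply: connect_sub u v => u v /orP[]/eqP->.
  have sub u v : connect (step e1 n1) u v -> connect (step e n) u v.
    by apply: connect_sub u v => u v /orP[]/eqP->; [exact: sub1|].
  by move=> u; have /andP[/sub-> /sub->] := h4 u.
split=> [u|u|u]; rewrite inc'.
- by case/norP=> uy u0; rewrite h1 // n1o // inc'; apply/norP.
- case/orP=> uy; last by rewrite !inc'; have /andP[-> ->] := h2 _ uy; rewrite !orbT.
  have nu v : v \in [:: y; y'] -> v \notin xs ++ ys by move=> vy; apply/negP=> /nq/negP.
  have E : e1 u \in [:: y; y'] by move: uy; rewrite !inE => /orP[]/eqP->; rewrite ?e1y ?e1y' eqxx ?orbT.
  rewrite h3 ?nu // h1 ?nu // !inc' E /=.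
  by move: uy; rewrite !inE => /orP[]/eqP->; rewrite ?n1y ?n1y' eqxx ?orbT.
- case/norP=> uy u0; rewrite inc' => /norP[euy eu0].
  by rewrite h3 ?e1o.
Qed.
End Surgery.

(** * Restriction to a component *)

Section Restriction.
Variables (T : finType) (P : pred T).

Section OnePerm.
Variable s : {perm T}.
Hypothesis closedP : forall u, P u -> P (s u).

Lemma restr_fun_inj : injective (fun u : {x | P x} => exist P (s (val u)) (closedP (valP u))).
Proof. by move=> u v /(congr1 val) /perm_inj /val_inj. Qed.

Definition sub_perm : {perm {x | P x}} := perm restr_fun_inj.

Lemma val_sub_perm u : val (sub_perm u) = s (val u).
Proof. by rewrite permE. Qed.

Lemma val_sub_permX i u : val ((sub_perm ^+ i) u) = (s ^+ i) (val u).
Proof.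
by elim: i => [|i IH]; rewrite ?expg0 ?perm1 // !expgSr !permM val_sub_perm IH.
Qed.

Lemma val_porbit u : val @: porbit sub_perm u = porbit s (val u).
Proof.
apply/setP => y; apply/imsetP/porbitP => [[_ /porbitP[i ->] ->]|[i ->]].
  by exists i; rewrite val_sub_permX.
by exists ((sub_perm ^+ i) u); rewrite ?val_sub_permX // mem_porbit.
Qed.

Lemma card_porbits_sub :
  #|porbits sub_perm| = #|[set O in porbits s | O \subset P]|.
Proof.
rewrite -(card_imset (porbits sub_perm) (imset_inj val_inj)).
apply: eq_card => O; rewrite inE; apply/imsetP/andP.
  move=> [_ /imsetP[u _ ->] ->]; rewrite val_porbit imset_f //; split=> //.
  rewrite -val_porbit; apply/fintype.subsetP => _ /imsetP[v _ ->]; exact: valP.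
move=> [/imsetP[x _ ->]] /fintype.subsetP/(_ x (porbit_id _ _)) Px.
by exists (porbit sub_perm (exist P x Px)); rewrite ?imset_f // val_porbit.
Qed.

Lemma closedV u : P (s u) -> P u.
Proof.
move=> Psu; have : u \in porbit s (s u) by rewrite porbit_sym mem_porbit_next.
case/porbitP=> i ->; elim: i => [|i IH]; rewrite ?expg0 ?perm1 //.
by rewrite expgSr permM closedP.
Qed.

Lemma map_val_orbit u :
  map val (fingraph.orbit sub_perm u) = fingraph.orbit s (val u).
Proof.
by apply/esym/map_orbit => [|v _]; [exact: val_inj|rewrite val_sub_perm].
Qed.
End OnePerm.

Lemma connect_sub_perm (s t : {perm T}) (hs : forall u, P u -> P (s u))
    (ht : forall u, P u -> P (t u)) (u v : {x | P x}) :
  connect (step (sub_perm hs) (sub_perm ht)) u v = connect (step s t) (val u) (val v).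
Proof.
apply/idP/idP => h.
  apply: (connect_invariant (P := fun v => connect (step s t) (val u) (val v)) _ h (connect0 _ _)).
  move=> x y xy /connect_trans; apply; apply: connect1.
  by case/orP: xy => /eqP->; rewrite /step val_sub_perm eqxx ?orbT.
have : [exists w, (val w == val v) && connect (step (sub_perm hs) (sub_perm ht)) u w].
  apply: (connect_invariant (P := fun x => [exists w, (val w == x) && connect (step (sub_perm hs) (sub_perm ht)) u w]) _ h).
    move=> x y xy /existsP[w /andP[/eqP wx uw]]; apply/existsP; subst x.
    case/orP: xy => /eqP->.
      exists (sub_perm hs w); rewrite val_sub_perm eqxx; apply: connect_trans uw _.
      by apply: connect1; rewrite /step eqxx.
    exists (sub_perm ht w); rewrite val_sub_perm eqxx; apply: connect_trans uw _.
    by apply: connect1; rewrite /step eqxx orbT.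
  by apply/existsP; exists u; rewrite eqxx connect0.
by case/existsP=> w /andP[/eqP/val_inj->].
Qed.
End Restriction.

Lemma sub_perm_M (T : finType) (P : pred T) (s t : {perm T})
    (hs : forall u, P u -> P (s u)) (ht : forall u, P u -> P (t u))
    (hst : forall u, P u -> P ((s * t) u)) :
  sub_perm hst = sub_perm hs * sub_perm ht.
Proof. by apply/permP => u; apply: val_inj; rewrite permM !val_sub_perm permM. Qed.

Lemma edge_perm_sub (T : finType) (P : pred T) (e : {perm T})
  (he : forall u, P u -> P (e u)) : edge_perm e -> edge_perm (sub_perm he).
Proof.
move=> [eK ne]; split=> u; first by apply: val_inj; rewrite !val_sub_perm.
by rewrite -val_eqE /= val_sub_perm ne.
Qed.

Lemma porbits_split (T : finType) (P : pred T) (s : {perm T})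
    (h : forall u, P u -> P (s u)) (h' : forall u, predC P u -> predC P (s u)) :
  #|porbits s| = #|porbits (sub_perm h)| + #|porbits (sub_perm h')|.
Proof.
rewrite !card_porbits_sub -(cardsID [set O : {set T} | O \subset P]).
congr (_ + _); apply: eq_card => O; rewrite !inE //.
rewrite andbC; apply: andb_id2l => /imsetP[x _ ->].
have [Px|Px] := boolP (P x).
  have sub : porbit s x \subset P.
    have := @porbit_sub _ s [set u | P u] x; rewrite inE => /(_ _ Px) sub.
    apply: subset_trans (sub _) _; last by apply/fintype.subsetP => u; rewrite inE.
    by move=> u; rewrite !inE; exact: h.
  rewrite sub; apply/esym/negbTE/subsetPn; exists x; rewrite ?porbit_id //.
  by rewrite !inE negbK.
have sub : porbit s x \subset predC P.
  have := @porbit_sub _ s [set u | predC P u] x; rewrite inE => /(_ _ Px) sub.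
  apply: subset_trans (sub _) _; last by apply/fintype.subsetP => u; rewrite inE.
  by move=> u; rewrite !inE; exact: h'.
rewrite sub; apply/subsetPn; exists x; rewrite ?porbit_id //.
Qed.

Lemma ncomp1 (T : finType) (s t : {perm T}) (b : T) :
  (forall x, connect (step s t) b x) -> ncomp s t = 1%N.
Proof.
have ss := @step_sym _ s t => h.
rewrite /ncomp -(card1 (root (step s t) b)); apply: eq_card => x.
rewrite [LHS]inE [RHS]inE; apply/eqP/eqP => [rx|->]; last exact/eqP/roots_root.
by rewrite -rx; apply/eqP; rewrite root_connect // ss.
Qed.

(** The component of [b] is planar: the Euler characteristics of the components
    add up to twice their number, and the other components, taken together,
    contribute at most that much by [genus_ge0]. *)
Lemma restrict_diagram (P : presentation) (T : finType) (lab : T -> letter P)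
    (e n : {perm T}) (b : T) (X := connect (step e n) b) :
  edge_perm e -> planar e n -> label_compat lab e ->
  (forall d, X d -> d \notin fingraph.orbit n b ->
     reads_relator (map lab (fingraph.orbit n d))) ->
  exists D, van_kampen (P := P) (map lab (fingraph.orbit n b)) D /\
    (area D).+1 = #|[set O in porbits n | O \subset X]|.
Proof.
move=> He pl lc rel.
have hX (s : {perm T}) : (forall x, step e n x (s x)) -> (forall u, X u -> X (s u)).
  by move=> h u /connect_trans; apply; apply: connect1.
have hX' (s : {perm T}) : (forall x, step e n x (s x)) -> (forall u, predC X u -> predC X (s u)).
  move=> h u /=; apply: contra; rewrite /X => /connect_trans; apply.
  by rewrite step_sym; apply: connect1.
have se x : step e n x (e x) by rewrite /step eqxx.
have sn x : step e n x (n x) by rewrite /step eqxx orbT.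
pose he := hX _ se; pose hn := hX _ sn; pose he' := hX' _ se; pose hn' := hX' _ sn.
have hm u : X u -> X ((e * n) u) by rewrite permM => /he/hn.
have hm' u : predC X u -> predC X ((e * n) u) by rewrite permM => /he'/hn'.
pose b1 : {x | X x} := exist X b (connect0 _ _).
have conn1 u : connect (step (sub_perm he) (sub_perm hn)) b1 u.
  by rewrite connect_sub_perm; apply: (valP u).
have conn d d' : connect (step (sub_perm he) (sub_perm hn)) d d'.
  by apply: connect_trans (conn1 d'); rewrite step_sym.
have He1 := edge_perm_sub he He.
have C1 : ncomp (sub_perm he) (sub_perm hn) = 1%N by exact: ncomp1 conn1.
have C2 : (ncomp (sub_perm he') (sub_perm hn')).+1 <= ncomp e n.
  rewrite /ncomp (cardD1 (root (step e n) b)) (_ : _ \in _); last first.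
    exact: (roots_root (@step_sym _ e n)).
  rewrite add1n ltnS.
  rewrite -(card_in_imset (f := fun u => root (step e n) (val u))
     (D := roots (step (sub_perm he') (sub_perm hn')))).
    apply/subset_leq_card/fintype.subsetP => _ /imsetP[u _ ->].
    rewrite !inE; apply/andP; split; last exact: (roots_root (@step_sym _ e n)).
    rewrite root_connect; last exact: step_sym.
    rewrite step_sym; exact: (valP u).
  move=> u v /eqP ru /eqP rv /eqP; rewrite root_connect; last exact: step_sym.
  rewrite -(connect_sub_perm he' hn') -root_connect; last exact: step_sym.
  by rewrite ru rv => /eqP.
have g1 := genus_ge0 (sub_perm he) (sub_perm hn).
have g2 := genus_ge0 (sub_perm he') (sub_perm hn').
have c1 := card_edge_perm He1.
have c2 := card_edge_perm (edge_perm_sub he' He).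
have pE : (#|porbits (sub_perm he * sub_perm hn)| + #|porbits (sub_perm hn)| =
    #|porbits (sub_perm he)| + 2)%N.
  move: pl; rewrite /planar (porbits_split he he') (porbits_split hn hn').
  rewrite (porbits_split hm hm') !(sub_perm_M _ _ hm) (sub_perm_M he' hn' hm').
  move: g1 g2; rewrite C1 -c1 -c2; lia.
have T0 : (0 < #|{: {x | X x}}|)%N by apply/card_gt0P; exists b1.
pose D := @DiskDiagram {x | X x} (sub_perm he) (sub_perm hn) (Some b1)
  He1.1 He1.2 conn (fun _ => pE) (esym T0).
have oE : porbit (sub_perm hn) b1 \in porbits (sub_perm hn) by exact: imset_f.
exists D; split; last first.
  rewrite /area /faces /outer_cell /= -card_porbits_sub.
  by rewrite [RHS](cardsD1 (porbit (sub_perm hn) b1)) oE.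
exists (fun d => lab (val d)); split.
- by move=> d; rewrite /= val_sub_perm lc.
- move=> d dn; rewrite map_comp map_val_orbit; apply: rel (valP d) _.
  rewrite (_ : b = val b1) // -map_val_orbit.
  apply: contra dn; rewrite /outer_cell /= -mem_orbit_porbit => /mapP[u + /val_inj ->].
  done.
- by rewrite /boundary_walk /= map_comp map_val_orbit.
Qed.

(** * Boundary words of planar maps *)

Lemma winvK (S : Type) : involutive (@winv S).
Proof. by move=> w; rewrite /winv map_rev revK -map_comp -[RHS]map_id; apply: eq_map; exact: linvK. Qed.

Lemma rot_rot_ex (S : Type) (v : seq S) i j : exists l, rot i (rot j v) = rot l v.
Proof.
have [le|lt] := leqP (size v) i; first by exists j; rewrite rot_oversize ?size_rot.
have [le|lt'] := leqP (size v) j; first by exists i; rewrite (rot_oversize le).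
by exists (if i + j <= size v then i + j else i + j - size v); rewrite rot_add_mod // ltnW.
Qed.

Lemma reads_relator_rot (P : presentation) (u : word P) k :
  reads_relator u -> reads_relator (rot k u).
Proof.
case=> r [rP [i [->|->]]]; exists r; split => //.
  by have [l ->] := rot_rot_ex r k i; exists l; left.
by have [l ->] := rot_rot_ex (winv r) k i; exists l; right.
Qed.

Lemma porbits_injection (T T' : finType) (s : {perm T}) (s' : {perm T'})
    (f : T -> T') (A : {set {set T'}}) :
  (forall x, porbit s' (f x) \in A) ->
  (forall x y, f y \in porbit s' (f x) -> y \in porbit s x) ->
  #|porbits s| <= #|A|.
Proof.
move=> fA fs; pose g (O : {set T'}) := \bigcup_(x | f x \in O) porbit s x.
apply: (@leq_trans #|g @: A|); last exact: leq_imset_card.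
apply/subset_leq_card/fintype.subsetP => _ /imsetP[x _ ->].
apply/imsetP; exists (porbit s' (f x)) => //.
apply/eqP; rewrite eqEsubset; apply/andP; split.
  by rewrite /g (bigcup_sup x) // porbit_id.
by apply/bigcupsP => y /fs; rewrite -eq_porbit_mem => /eqP->.
Qed.

Lemma orbit_agree (T : finType) (n n' : {perm T}) d :
  (forall u, u \in fingraph.orbit n d -> n' u = n u) ->
  fingraph.orbit n' d = fingraph.orbit n d.
Proof.
by move=> h; rewrite -[d in LHS]/(id d) (map_orbit (s := n) (f := id)) ?map_id.
Qed.

Lemma orbit_avoid (T : finType) (n n' : {perm T}) (c : seq T) d :
  (forall u, u \in c -> n u \in c) -> (forall u, u \notin c -> n' u = n u) ->
  d \notin c -> fingraph.orbit n' d = fingraph.orbit n d.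
Proof.
move=> cc h dc; apply: orbit_agree => u ud; apply: h; apply: contra dc => uc.
move: ud; rewrite mem_orbit_porbit porbit_sym => /porbitP[i ->].
elim: i => [|i IH]; first by rewrite expg0 perm1.
by rewrite expgSr permM cc.
Qed.

Lemma map_eq_cat (T L : Type) (f : T -> L) c u v : map f c = u ++ v ->
  exists c1 c2, [/\ c = c1 ++ c2, map f c1 = u & map f c2 = v].
Proof.
move=> E; exists (take (size u) c), (drop (size u) c).
by rewrite cat_take_drop map_take map_drop E take_size_cat // drop_size_cat.
Qed.

Section Existence.
Variable P : presentation.
Implicit Type w : word P.

(** The outer boundary is a list [c] of darts rather than a base point, so that
    it may be rotated freely and may be empty.  Components away from [c] are
    left unconstrained, since they may be debris of [close_bigon]. *)
Definition spherical w := exists (T : finType) (lab : T -> letter P)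
    (e n : {perm T}) (c : seq T),
  [/\ edge_perm e, planar e n & label_compat lab e] /\
  [/\ fcycle n c, uniq c, map lab c = w &
    forall x d, x \in c -> connect (step e n) x d -> d \notin c ->
      reads_relator (map lab (fingraph.orbit n d))].

Lemma spherical_diagram w : spherical w -> exists D, van_kampen (P := P) w D.
Proof.
case=> T [lab [e [n [c [[He pl lc] [cc uc <- rel]]]]]].
case: c cc uc rel => [|b c] cc uc rel; last first.
  have oE : fingraph.orbit n b = b :: c.
    by rewrite (fingraph.orbitE cc uc) ?mem_head //= eqxx rot0.
  have [D [vk _]] : exists D, van_kampen (P := P) (map lab (fingraph.orbit n b)) D /\
     (area D).+1 = #|[set O in porbits n | O \subset connect (step e n) b]|.
    apply: restrict_diagram He pl lc _ => d; rewrite oE => bd dn.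
    exact: rel (mem_head _ _) bd dn.
  by exists D; rewrite -oE.
have v0 : (0 < #|{: void}|)%N -> forall Q : Prop, Q by rewrite card_void.
pose D := @DiskDiagram void 1 1 None (fun d => match d with end)
  (fun d => match d with end) (fun d => match d with end) (fun h => v0 h _) (esym (f_equal (leq 1) card_void)).
exists D, (fun d : void => match d with end); split=> //; by case.
Qed.

Lemma spherical_rot w k : spherical w -> spherical (rot k w).
Proof.
case=> T [lab [e [n [c [sys [cc uc <- rel]]]]]].
exists T, lab, e, n, (rot k c); split => //; split; rewrite ?rot_cycle ?rot_uniq ?map_rot //.
by move=> x d; rewrite !mem_rot; exact: rel.
Qed.

Lemma spherical_catC (w v : word P) : spherical (w ++ v) <-> spherical (v ++ w).
Proof.
have h (u u' : word P) : spherical (u ++ u') -> spherical (u' ++ u).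
  by move/(spherical_rot (size u)); rewrite rot_size_cat.
by split; exact: h.
Qed.

Lemma spherical_nil : spherical [::].
Proof.
exists void, (fun d : void => match d with end), 1, 1, [::].
split; last by split.
split; [by split; case| |by case].
rewrite /planar [ncomp _ _](_ : _ = 0%N); last first.
  by apply/eqP; rewrite -leqn0 -card_void; exact: max_card.
by rewrite addn0 leq_addr.
Qed.

(** Pinching the outer face together at the two ends of the arc that reads [v]
    cuts off an inner face that reads [v]. *)
Lemma spherical_split w v : spherical (w ++ v) -> reads_relator v -> spherical w.
Proof.
case: w => [|a w]; first by move=> *; exact: spherical_nil.
case: v => [|b v]; first by rewrite cats0.
case=> T [lab [e [n [c [[He pl lc] [cc uc cE rel]]]]]] rv.
have [[|x1 p1] [[|x2 p2] [E1 E2 E3]]] := map_eq_cat cE => //.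
rewrite {}E1 in cc uc cE rel.
have [c1 c2 o1 o2] := split_cycle cc uc.
set n1 := _ * n in c1 c2 o1.
move: (uc); rewrite cat_uniq => /and3P[u1 _ u2].
exists T, lab, e, n1, (x1 :: p1); split; first by split=> //; apply: planar_tperm => //; left.
split=> // x d x1c cxd dn.
have [d2|d2] := boolP (d \in x2 :: p2).
  have [i ->] := orbit_rot_cycle c2 u2 d2.
  by rewrite map_rot E3; apply: reads_relator_rot.
have dc : d \notin (x1 :: p1) ++ x2 :: p2 by rewrite mem_cat negb_or dn.
rewrite (orbit_avoid (mem_fcycle cc) o1 dc); apply: (rel x d) => //; last first.
  apply: connect_sub cxd => u v' /orP[]/eqP->.
    by apply: porbit_connectl; exact: mem_porbit_next.
  by apply: porbit_connectr; apply: porbit_tperm.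
by rewrite mem_cat x1c.
Qed.

(** The face cut off by pinching the ends of the arc that reads [v v^-1] zips up
    to nothing. *)
Lemma spherical_fold w v : spherical (w ++ v ++ winv v) -> spherical w.
Proof.
case: w => [|a w]; first by move=> *; exact: spherical_nil.
case: v => [|b v]; first by rewrite cats0.
case=> T [lab [e [n [c [[He pl lc] [cc uc cE rel]]]]]].
set vv := _ ++ winv _ in cE.
have [[|x1 p1] [[|x2 p2] [E1 E2 E3]]] := map_eq_cat cE => //.
rewrite {}E1 in cc uc cE rel.
have [c1 c2 o1 o2] := split_cycle cc uc.
set n1 := _ * n in c1 c2 o1.
have pl1 : planar e n1 by apply: planar_tperm => //; left.
move: (uc); rewrite cat_uniq => /and3P[u1 /hasPn dis u2].
have {}dis u : u \in x1 :: p1 -> u \notin x2 :: p2 by move=> h; apply/negP => /dis/negP.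
pose xs := take (size (b :: v)) (x2 :: p2); pose ys := drop (size (b :: v)) (x2 :: p2).
have xyE : xs ++ ys = x2 :: p2 by exact: cat_take_drop.
have lxy : map lab ys = winv (map lab xs).
  by rewrite /xs /ys map_drop map_take E3 drop_size_cat // take_size_cat.
move: c2 u2; rewrite -xyE => c2 u2.
have [e' [n' [[He' pl' lc'] [[h1 h2 _] h4]]]] := zip_cycle He pl1 lc c2 u2 lxy.
rewrite xyE in h1 h2.
have h2' u (s : {perm T}) : (forall u, u \in x2 :: p2 -> s u \in x2 :: p2) ->
    u \notin x2 :: p2 -> s u \notin x2 :: p2.
  move=> hs; apply: contra => h.
  exact: (closedV (P := mem (x2 :: p2)) hs h).
have cc1 : fcycle n' (x1 :: p1).
  apply: (sub_in_cycle (P := mem (x1 :: p1))) c1; last exact/allP.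
  by move=> u z uo _ /=; rewrite h1 ?dis.
exists T, lab, e', n', (x1 :: p1); split; first by split.
split=> // x d x1c cxd dn.
have d2 : d \notin x2 :: p2.
  apply: (connect_invariant (P := [pred d | d \notin x2 :: p2]) _ cxd (dis _ x1c)).
  move=> u z /orP[]/eqP->; apply: h2' => {}u /h2/andP[] //.
have dc : d \notin (x1 :: p1) ++ x2 :: p2 by rewrite mem_cat negb_or dn.
have -> : fingraph.orbit n' d = fingraph.orbit n d.
  apply: (orbit_avoid (mem_fcycle cc)) dc => u; rewrite mem_cat => /norP[u1' u2'].
  by rewrite h1 // o1 // mem_cat; apply/norP.
apply: (rel x d) => //; first by rewrite mem_cat x1c.
have s1 u z : connect (step e n1) u z -> connect (step e n) u z.
  apply: connect_sub u z => u z /orP[]/eqP->.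
    by apply: porbit_connectl; exact: mem_porbit_next.
  by apply: porbit_connectr; apply: porbit_tperm.
apply: connect_sub cxd => u z /orP[]/eqP->; apply: s1; by have /andP[] := h4 u.
Qed.

End Existence.

(** * Van Kampen's lemma *)

Section Spike.
Variables (T : finType) (e n : {perm T}) (p : T).
Hypotheses (He : edge_perm e) (pl : planar e n).

(** A new edge sticking out into the face of [p]: [inr true] follows [p] and
    leads to a new vertex of degree one, and [inr false] leads back. *)
Definition spike_edge_fun (u : T + bool) : T + bool :=
  match u with inl t => inl (e t) | inr b => inr (~~ b) end.

Definition spike_next_fun (u : T + bool) : T + bool :=
  match u with
  | inl t => if t == p then inr true else inl (n t)
  | inr true => inr false
  | inr false => inl (n p)
  end.

Lemma spike_edge_inj : injective spike_edge_fun.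
Proof. by move=> [x|[]] [y|[]] //= [] // /perm_inj ->. Qed.

Lemma spike_next_inj : injective spike_next_fun.
Proof.
have np z : (if z == p then inr true else inl (n z)) <> inl (n p) :> T + bool.
  by case: eqVneq => // zp [/perm_inj/eqP]; rewrite (negPf zp).
have nt z : (if z == p then inr true else inl (n z)) <> inr false :> T + bool.
  by case: eqVneq.
move=> [x|[]] [y|[]] //=.
- by case: eqVneq => [->|_]; case: eqVneq => [->|_] // [/perm_inj ->].
- by move/nt.
- by move/np.
- by move/esym/nt.
- by move/esym/np.
Qed.

Definition spike_edge := perm spike_edge_inj.
Definition spike_next := perm spike_next_inj.

Lemma edge_perm_spike : edge_perm spike_edge.
Proof.
have [eK ne] := He.
by split=> [[t|b]|[t|[]]]; rewrite !permE //= ?eK ?negbK // (inj_eq inl_inj) ne.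
Qed.

(** [ret] contracts the new edge; orbits can be compared through it. *)
Lemma porbit_ret (s : {perm T}) (s' : {perm (T + bool)}) (ret : T + bool -> T) :
  (forall u, ret (s' u) \in porbit s (ret u)) ->
  forall u v, v \in porbit s' u -> ret v \in porbit s (ret u).
Proof.
move=> h u _ /porbitP[i ->]; elim: i => [|i IH]; first by rewrite expg0 perm1 porbit_id.
rewrite expgSr permM; move: IH (h ((s' ^+ i) u)).
by rewrite -!eq_porbit_mem => /eqP <-.
Qed.

Lemma planar_spike : planar spike_edge spike_next.
Proof.
have E1 : #|porbits spike_edge| = #|porbits e|.+1.
  apply: double_inj; rewrite doubleS !card_edge_perm ?card_sum ?card_bool ?addn2 //.
  exact: edge_perm_spike.
have F1 : #|porbits n| <= #|porbits spike_next|.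
  apply: (porbits_injection (s' := spike_next) (f := inl)) => [x|x y]; first exact: imset_f.
  apply: (@porbit_ret _ _ (fun u => if u is inl t then t else p)).
  case=> [t|[]]; rewrite permE /= ?porbit_id ?mem_porbit_next //.
  by case: eqP => [->|_]; rewrite ?porbit_id ?mem_porbit_next.
have V1 : #|porbits (e * n)|.+1 <= #|porbits (spike_edge * spike_next)|.
  have [eK ne] := He.
  have h u v : v \in porbit (spike_edge * spike_next) u ->
      (if v is inl t then t else e p) \in porbit (e * n) (if u is inl t then t else e p).
    apply: (@porbit_ret _ _ (fun u => if u is inl t then t else e p)).
    case=> [t|[]]; rewrite permM [spike_edge _]permE /= permE /= ?porbit_id //.
      case: eqP => [<-|_]; first by rewrite eK porbit_id.
      by rewrite -permM mem_porbit_next.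
    by have := mem_porbit_next (e * n) (e p); rewrite permM eK.
  have fx : (spike_edge * spike_next) (inr false) = inr false.
    by rewrite permM [spike_edge _]permE /= permE.
  have px : porbit (spike_edge * spike_next) (inr false) = [set inr false].
    apply/eqP; rewrite eqEsubset sub1set porbit_id andbT.
    by apply: porbit_sub; [move=> u /set1P->; rewrite fx set11|rewrite set11].
  rewrite (cardsD1 [set inr false]) -{1}px imset_f // add1n ltnS.
  apply: (porbits_injection (s' := spike_edge * spike_next) (f := inl)) => [x|x y]; last exact: h.
  rewrite !inE imset_f // andbT; apply/eqP => /setP/(_ (inl x)).
  by rewrite porbit_id inE.
have C1 : ncomp spike_edge spike_next <= ncomp e n.
  pose ret (u : T + bool) := if u is inl t then t else p.
  have s' := @step_sym _ spike_edge spike_next.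
  have cl x y : connect (step e n) x y -> connect (step spike_edge spike_next) (inl x) (inl y).
    move=> h; apply: (connect_invariant (P := fun y => connect (step spike_edge spike_next) (inl x) (inl y)) _ h (connect0 _ _)).
    move=> u v uv /connect_trans; apply.
    have cn w := @porbit_connectr _ spike_edge spike_next _ _ (mem_porbit_next spike_next w).
    have ce w := @porbit_connectl _ spike_edge spike_next _ _ (mem_porbit_next spike_edge w).
    case/orP: uv => /eqP->; first by have := ce (inl u); rewrite permE.
    have := cn (inl u); rewrite permE /=; case: eqP => // -> h1.
    apply: connect_trans h1 _; have := cn (inr true); rewrite permE /= => h1.
    by apply: connect_trans h1 _; have := cn (inr false); rewrite permE /=.
  have cr u : connect (step spike_edge spike_next) (inl (ret u)) u.
    case: u => [t|b] /=; first exact: connect0.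
    have := @porbit_connectr _ spike_edge spike_next _ _ (mem_porbit_next spike_next (inl p)).
    rewrite permE /= eqxx; case: b => // h; apply: connect_trans h _.
    have := @porbit_connectr _ spike_edge spike_next _ _ (mem_porbit_next spike_next (inr true)).
    by rewrite permE.
  rewrite /ncomp -(card_in_imset (f := fun u => root (step e n) (ret u))
     (D := roots (step spike_edge spike_next))).
    apply/subset_leq_card/fintype.subsetP => _ /imsetP[u _ ->].
    exact: (roots_root (@step_sym _ e n)).
  move=> u v /eqP ru /eqP rv /eqP; rewrite root_connect; last exact: step_sym.
  move/cl => h; apply/eqP; rewrite -ru -rv root_connect //.
  by apply: connect_trans (cr v); apply: connect_trans h; rewrite s'.
by move: pl; rewrite /planar E1; lia.
Qed.
End Spike.

Section VanKampen.
Variable P : presentation.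
Implicit Type w : word P.

Lemma spherical_edge (x : letter P) : spherical [:: x; linv x].
Proof.
pose s : {perm bool} := perm negb_inj.
have sE b : s b = ~~ b by rewrite permE.
have He : edge_perm s by split=> [] []; rewrite !sE.
pose lab b : letter P := if b then x else linv x.
exists bool, lab, s, s, [:: true; false]; split.
  split=> //; last by case; rewrite sE /lab //= linvK.
  have ss : s * s = 1 by apply/permP => b; rewrite permM perm1 !sE negbK.
  have C1 : ncomp s s = 1%N.
    apply: (@ncomp1 _ s s true) => -[]; first exact: connect0.
    by apply: connect1; rewrite /step sE.
  rewrite /planar ss porbits1 C1 card_bool.
  by move: (card_edge_perm He); rewrite card_bool; lia.
by split=> //= [|y [] //]; rewrite !sE.
Qed.

Lemma spherical_spike w (x : letter P) : spherical w -> spherical (w ++ [:: x; linv x]).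
Proof.
case: w => [|a w]; first by move=> _; exact: spherical_edge.
case=> T [lab [e [n [[|d0 c] [[He pl lc] [cc uc cE rel]]]]]]; first by [].
set p := last d0 c; pose e' := spike_edge e; pose n' := spike_next n p.
pose lab' u := match u with inl t => lab t | inr b => if b then x else linv x end.
have n'i t : t != p -> n' (inl t) = inl (n t) by move=> tp; rewrite permE /= (negPf tp).
have pc : p \in d0 :: c by rewrite mem_last.
pose c' : seq (T + bool) := map inl (d0 :: c) ++ [:: inr true; inr false].
have c'i t : (inl t \in c') = (t \in d0 :: c).
  by rewrite mem_cat (mem_map inl_inj) !inE !orbF.
exists (T + bool)%type, lab', e', n', c'; split.
  split; [exact: edge_perm_spike|exact: planar_spike|].
  by case=> [t|[]]; rewrite permE //= linvK.
split.
- have np : n p = d0.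
    by move: cc; rewrite /= rcons_path => /andP[_ /eqP].
  have pp : path (frel n') (inl d0) (map inl c).
    move: cc uc n'i; rewrite /p /= rcons_path => /andP[+ _].
    elim: (c) (d0) => //= d1 q IH d2 /andP[/eqP nd pq] /andP[d2q uq] n'i.
    rewrite n'i ?nd ?eqxx /=; last by apply: contraNneq d2q => {1}->; exact: mem_last.
    exact: IH.
  rewrite /c' /= rcons_cat cat_path pp /= (last_map inl) -/p !permE /= eqxx np.
  by rewrite !eqxx.
- rewrite cat_uniq (map_inj_uniq inl_inj) uc /= andbT.
  by rewrite !inE /= !orbF; apply/norP; split; apply/mapP => -[].
- by rewrite /c' map_cat -map_comp -cE.
- move=> x0 [d|b]; last first.
    by move=> _ _; case: b; rewrite mem_cat !inE eqxx ?orbT.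
  rewrite c'i => x0c cxd dn.
  pose ret (u : T + bool) := if u is inl t then t else p.
  have x0r : ret x0 \in d0 :: c.
    by case: x0 x0c {cxd} => [t|b] //=; rewrite c'i.
  have rd : connect (step e n) (ret x0) d.
    apply: (connect_invariant (P := fun v => connect (step e n) (ret x0) (ret v)) _ cxd (connect0 _ _)).
    move=> u v uv /connect_trans; apply.
    have cn z := @porbit_connectr _ e n _ _ (mem_porbit_next n z).
    have ce z := @porbit_connectl _ e n _ _ (mem_porbit_next e z).
    case/orP: uv => /eqP->; rewrite permE; case: u => [t|[]] //=.
    by case: eqVneq => [->|].
  have -> : fingraph.orbit n' (inl d) = map inl (fingraph.orbit n d).
    apply: map_orbit inl_inj _ => u; rewrite mem_orbit_porbit => /porbitP[i ->].
    rewrite n'i //; apply: contraNneq dn => ip.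
    have : d \in porbit n p by rewrite -ip porbit_sym mem_porbit.
    case/porbitP=> k ->; elim: k => [|k IH]; rewrite ?expg0 ?perm1 //.
    by rewrite expgSr permM (mem_fcycle cc).
  by rewrite -map_comp; apply: rel x0r rd dn.
Qed.

Lemma spherical_insert_spike w w' (x : letter P) :
  spherical (w ++ w') -> spherical (w ++ [:: x; linv x] ++ w').
Proof.
by rewrite spherical_catC => /spherical_spike-/(_ x); rewrite -catA spherical_catC -catA.
Qed.

(** Attaching the letters of [v] one after another, each at the tip of the
    previous one; rotating the boundary word brings the tip to its end. *)
Lemma spherical_insert_path w v : spherical w -> spherical (w ++ v ++ winv v).
Proof.
elim: v w => [|x v IH] w; first by rewrite cats0.
move/spherical_spike => /(_ x) h.
have /IH : spherical ([:: linv x] ++ (w ++ [:: x])) by rewrite spherical_catC -catA.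
rewrite -catA spherical_catC -!catA.
by rewrite /winv map_cons rev_cons -cats1.
Qed.

(** A relator is erased by capping it off with a face.  It is inserted by
    attaching a path that reads [r r^-1] and capping off [r^-1]. *)
Lemma spherical_group_eq (u v : word P) : group_eq u v -> spherical u <-> spherical v.
Proof.
elim=> {u v} [u|u v _ [] //|u v w _ [uv vu] _ [vw wv]|u x v|u r v rP].
- by [].
- by split=> [/uv/vw|/wv/vu].
- split; last exact: spherical_insert_spike.
  rewrite catA spherical_catC catA => /(@spherical_fold _ _ [:: x]).
  by rewrite spherical_catC.
have r1 : reads_relator r by exists r; split=> //; exists 0; left; rewrite rot0.
have r2 : reads_relator (winv r) by exists r; split=> //; exists 0; right; rewrite rot0.
split.
  rewrite catA spherical_catC catA => /spherical_split/(_ r1).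
  by rewrite spherical_catC.
move/(spherical_catC _ _).1/(@spherical_insert_path _ r).
rewrite catA => /spherical_split/(_ r2).
by rewrite -catA spherical_catC -catA.
Qed.

Theorem van_kampen_exists w : null_homotopic w -> exists D, van_kampen (P := P) w D.
Proof.
move=> /spherical_group_eq [_ /(_ (spherical_nil P))]; exact: spherical_diagram.
Qed.
End VanKampen.

(** * Cancellation of mirror faces *)

Section Cancellation.
Variables (P : presentation) (w : word P) (D : disk_diagram).

Lemma diagram_edge_perm : edge_perm (drev D).
Proof. by split; [exact: drevK|exact: drev_neq]. Qed.

Lemma ncomp_diagram : 0 < #|dart D| -> ncomp (drev D) (dnext D) = 1%N.
Proof.
by case/card_gt0P => b _; apply: (@ncomp1 _ _ _ b) => x; exact: dart_connected.
Qed.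

Lemma planar_diagram : 0 < #|dart D| -> planar (drev D) (dnext D).
Proof.
by move=> D0; rewrite /planar ncomp_diagram //; have := dart_planar D0; lia.
Qed.

Lemma outer_cellE b : base D = Some b -> outer_cell D = porbit (dnext D) b.
Proof. by rewrite /outer_cell => ->. Qed.

Lemma mem_outer_next d : (dnext D d \in outer_cell D) = (d \in outer_cell D).
Proof.
rewrite /outer_cell; case: (base D) => [b|] //=; last by rewrite !in_set0.
by rewrite -!eq_porbit_mem; have := porbit_perm (dnext D) 1 d; rewrite expg1 => ->.
Qed.

Lemma card_porbits_diagram : 0 < #|dart D| -> #|porbits (dnext D)| = (area D).+1.
Proof.
rewrite -base_dart /area /faces; case bE: (base D) => [b|//] _.
rewrite (outer_cellE bE) (cardsD1 (porbit (dnext D) b) (porbits _)).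
by rewrite imset_f.
Qed.

(** The converse of [split_cycle]. *)
Lemma merge_cycle (T : finType) (n : {perm T}) x1 p1 x2 p2
    (n1 := tperm (last x1 p1) (last x2 p2) * n) :
  fcycle n (x1 :: p1) -> fcycle n (x2 :: p2) -> uniq ((x1 :: p1) ++ (x2 :: p2)) ->
  fcycle n1 ((x1 :: p1) ++ (x2 :: p2)) /\
  (forall u, u \notin (x1 :: p1) ++ (x2 :: p2) -> n1 u = n u).
Proof.
set l1 := last x1 p1 in n1 *; set l2 := last x2 p2 in n1 *.
have pn x p : fcycle n (x :: p) -> path (frel n) x p /\ n (last x p) = x.
  by rewrite /= rcons_path => /andP[? /eqP].
case/pn => [pa nl1] /pn[pb nl2] uc; rewrite -/l1 in nl1; rewrite -/l2 in nl2.
have n1u u : u != l1 -> u != l2 -> n1 u = n u.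
  by move=> u1 u2; rewrite permM tpermD // eq_sym.
have [u1 /hasPn dis u2] : [/\ uniq (x1 :: p1), ~~ has (mem (x1 :: p1)) (x2 :: p2) & uniq (x2 :: p2)].
  by move: uc; rewrite cat_uniq => /and3P[].
have dis' u : u \in x1 :: p1 -> u \notin x2 :: p2.
  by move=> h; apply/negP => /dis/negP.
split; last first.
  move=> u; rewrite mem_cat => /norP[v1 v2]; apply: n1u.
    by apply: contraNneq v1 => ->; rewrite mem_last.
  by apply: contraNneq v2 => ->; rewrite mem_last.
rewrite /= rcons_cat cat_path /= rcons_path -/l1 -/l2 /= permM tpermL nl2.
rewrite permM tpermR nl1 !eqxx andbT /=.
have inner x p z : uniq (x :: p) -> path (frel n) x p ->
    (forall u, u \in x :: p -> u != last x p -> n1 u = n u) -> path (frel n1) x p.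
  elim: p x {z} => //= y p IH x /andP[xp yp] /andP[/eqP nx py] h.
  rewrite h ?mem_head ?nx ?eqxx //=; last first.
    by apply: contraNneq xp => {1}->; exact: mem_last.
  by apply: IH => // u up; apply: h; rewrite inE up orbT.
apply/andP; split; apply: inner => // u ux ul; apply: n1u => //.
  by apply: contraTneq ux => ->; apply/negP => /dis'; rewrite mem_last.
by apply: contraTneq ux => ->; apply: dis'; rewrite mem_last.
Qed.

(** Two distinct inner faces that are mirror images of each other across an
    edge cancel: deleting the edge merges them into one face whose boundary
    reads a word followed by its inverse, and this face zips up. *)
Lemma cancel_mirror (lab : dart D -> letter P) d :
  (forall d, lab (drev D d) = linv (lab d)) ->
  (forall d, d \notin outer_cell D ->
     reads_relator (map lab (fingraph.orbit (dnext D) d))) ->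
  map lab (boundary_walk D) = w ->
  d \notin outer_cell D -> drev D d \notin outer_cell D ->
  drev D d \notin fingraph.orbit (dnext D) d ->
  rot 1 (map lab (fingraph.orbit (dnext D) (drev D d))) =
    winv (map lab (fingraph.orbit (dnext D) d)) ->
  exists2 D', van_kampen w D' & area D' < area D.
Proof.
set e := drev D; set n := dnext D => lc rel bw dO edO ned mir.
have D0 : 0 < #|dart D| by apply/card_gt0P; exists d.
have He : edge_perm e := diagram_edge_perm.
have pl : planar e n by exact: planar_diagram.
move: (D0); rewrite -base_dart; case bE: (base D) => [b|//] _.
have oE := outer_cellE bE; rewrite -/n in oE.
have orb z : exists q, fingraph.orbit n z = z :: q.
  by rewrite /fingraph.orbit -fingraph.orderSpred /=; eexists.
have [p1 xsE] := orb d.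
have [q ysE] := orb (e d).
have cx : fcycle n (d :: p1) by rewrite -xsE; exact: (cycle_orbit (@perm_inj _ n)).
have ux : uniq (d :: p1) by rewrite -xsE orbit_uniq.
have [x2 [p2 [yE yl]]] : exists x2 p2, rot 1 (e d :: q) = x2 :: p2 /\ last x2 p2 = e d.
  rewrite rot1_cons; case: (q) => [|x2 p2]; first by exists (e d), nil.
  by exists x2, (rcons p2 (e d)); split=> //; exact: last_rcons.
have cy : fcycle n (x2 :: p2).
  by rewrite -yE rot_cycle -ysE; exact: (cycle_orbit (@perm_inj _ n)).
have uy : uniq (x2 :: p2) by rewrite -yE rot_uniq -ysE orbit_uniq.
have my u : (u \in x2 :: p2) = (u \in porbit n (e d)).
  by rewrite -yE mem_rot -ysE mem_orbit_porbit.
have mx u : (u \in d :: p1) = (u \in porbit n d) by rewrite -xsE mem_orbit_porbit.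
have uc : uniq ((d :: p1) ++ (x2 :: p2)).
  rewrite cat_uniq ux uy andbT; apply/hasPn => u; rewrite my /= mx => uy'.
  apply: contra ned => ux'; rewrite mem_orbit_porbit.
  by move: ux' uy'; rewrite -!eq_porbit_mem => /eqP-> /eqP->.
set c := (d :: p1) ++ (x2 :: p2) in uc.
(* deleting the edge {d, e d}: both darts stay, as two consecutive darts of
   the merged face *)
have [cc n1o] := merge_cycle cx cy uc.
set n1 := _ * n in cc n1o.
have nl1 : n (last d p1) = d by move: cx; rewrite /= rcons_path => /andP[_ /eqP].
have pl1 : planar e n1.
  apply: planar_tperm pl; right; rewrite yl (edge_permV He) [e (e d)]drevK.
  have := mem_porbit_next (e * n) (e (last d p1)); rewrite permM [e (e _)]drevK nl1.
  done.
have lxy : map lab (x2 :: p2) = winv (map lab (d :: p1)).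
  by rewrite -yE map_rot -ysE mir xsE.
have [e' [n' [[He' pl' lc'] [[h1 h2 _] _]]]] := zip_cycle He pl1 lc cc uc lxy.
have h3 u : u \notin c -> n' u = n u by move=> uc'; rewrite h1 // n1o.
have cn u : u \in c -> n u \in c.
  by rewrite !mem_cat !mx !my => /orP[]/porbit_closed->; rewrite ?orbT.
have bc : b \notin c.
  rewrite mem_cat mx my; apply/norP; split.
    by rewrite porbit_sym -oE.
  by rewrite porbit_sym -oE.
have og u : u \notin c -> fingraph.orbit n' u = fingraph.orbit n u.
  exact: orbit_avoid cn h3.
have po u : u \notin c -> porbit n' u = porbit n u.
  by move=> uc'; apply/setP => z; rewrite -!mem_orbit_porbit og.
have Xc u : connect (step e' n') b u -> u \notin c.
  move=> bu; apply: (connect_invariant (P := [pred d | d \notin c]) _ bu bc) => x y.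
  by case/orP=> /eqP->; apply: contra; apply: (closedV (P := mem c)) => v /h2/andP[].
have rel' z : connect (step e' n') b z -> z \notin fingraph.orbit n' b ->
    reads_relator (map lab (fingraph.orbit n' z)).
  move=> /Xc zc; rewrite !og // => zO; apply: rel.
  by rewrite oE -mem_orbit_porbit.
have [D' [vk aE]] := restrict_diagram He' pl' lc' rel'.
exists D'.
  by rewrite (_ : w = map lab (fingraph.orbit n' b)) // og // -bw /boundary_walk bE.
rewrite -ltnS aE -card_porbits_diagram // (cardsD1 (porbit n d) (porbits n)) imset_f // ltnS.
apply/subset_leq_card/fintype.subsetP => O; rewrite !inE => /andP[/imsetP[z _ ->] sX].
have zc : z \notin c by apply: Xc; exact: (fintype.subsetP sX z (porbit_id _ _)).
rewrite po // imset_f // andbT; apply: contraNneq zc => /setP/(_ z).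
by rewrite porbit_id mem_cat mx => <-.
Qed.
End Cancellation.

(** * Isoperimetry from Euler's formula *)

(** The first-return permutation of [s] to the complement of [X], obtained by
    cutting the points of [X] out of the cycles of [s] one at a time. *)
Lemma first_return (T : finType) (s : {perm T}) (X : {set T}) :
  exists s' : {perm T}, [/\ forall u, u \in X -> s' u = u,
    forall u, s' u \in porbit s u
    & forall u, u \notin X -> s u \notin X -> s' u = s u].
Proof.
have [xs Xxs] : exists xs : seq T, X =i xs by exists (enum X) => x; rewrite mem_enum.
suff [s' [h1 h2 h3]] : exists s' : {perm T}, [/\ forall u, u \in xs -> s' u = u,
    forall u, s' u \in porbit s u
    & forall u, u \notin xs -> s u \notin xs -> s' u = s u].
  by exists s'; split=> // u; rewrite !Xxs; auto.
elim: xs {X Xxs} => [|x xs [s' [h1 h2 h3]]]; first by exists s; split=> // u; exact: mem_porbit_next.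
pose y := s'^-1 x; have s'y : s' y = x by rewrite permKV.
have yx : y \in porbit s' x by rewrite porbit_sym -{1}s'y mem_porbit_next.
exists (tperm x y * s'); split => u.
- rewrite inE; have [->|ux] /= := eqVneq u x; first by rewrite permM tpermL.
  move=> uxs; rewrite permM tpermD ?h1 // eq_sym //.
  by apply: contraNneq ux => uy; rewrite -s'y -uy h1.
- have sub : porbit s' u \subset porbit s u.
    apply: porbit_sub (porbit_id _ _) => v; rewrite -eq_porbit_mem => /eqP <-; exact: h2.
  exact: (fintype.subsetP sub) (porbit_tperm _ yx).
- rewrite !inE => /norP[ux uxs] /norP[sux suxs].
  rewrite permM tpermD ?h3 // eq_sym //.
  by apply: contraNneq sux => uy; rewrite -(h3 u) // uy s'y.
Qed.

Section Isoperimetry.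
Variables (T : finType) (e n : {perm T}) (A : {set T}).
Hypotheses (He : edge_perm e) (Hc : forall x y, connect (step e n) x y).
Hypothesis Hp : #|porbits e| + 2 <= #|porbits (e * n)| + #|porbits n|.
Hypothesis An : forall d, d \in A -> n d \in A.
Hypothesis A8 : forall d, d \in A -> 8 <= #|porbit n d|.
Let Ai := [set d in A | e d \in A].
Hypothesis Ai3 : forall d, porbit (e * n) d \subset Ai -> 3 <= #|porbit (e * n) d|.
Let dA := [set d in A | e d \notin A].

Let eK : involutive e := He.1.

Lemma interior_edge u : (e u \in Ai) = (u \in Ai).
Proof. by rewrite !inE eK andbC. Qed.

(** The edge reversal of the map that remains when the edges interior to the
    region [A] are deleted; their darts become isolated points. *)
Definition cut_fun u := if u \in Ai then u else e u.

Lemma cut_funK : involutive cut_fun.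
Proof.
move=> u; rewrite /cut_fun; case: (boolP (u \in Ai)) => uA; first by rewrite uA.
by rewrite interior_edge (negPf uA) eK.
Qed.

Definition cut_edges := perm (inv_inj cut_funK).

Lemma cut_edgesK : cut_edges * cut_edges = 1.
Proof. by apply/permP => u; rewrite permM perm1 !permE cut_funK. Qed.

Lemma card_porbits_sub_compl (s : {perm T}) (X : {set T}) :
  #|[set O in porbits s | ~~ (O \subset X)]| + #|[set O in porbits s | O \subset X]| =
  #|porbits s|.
Proof.
rewrite addnC -(cardsID [set O : {set T} | O \subset X] (porbits s)).
by congr (_ + _); apply: eq_card => O; rewrite !inE // andbC.
Qed.

Lemma card_cut_edges : #|T| + #|Ai| <= (#|porbits cut_edges|).*2.
Proof.
have hAi u : u \in Ai -> e u \in Ai by rewrite interior_edge.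
have c1 := card_edge_perm He.
have c2 : (#|[set O in porbits e | O \subset Ai]|).*2 = #|Ai|.
  rewrite -(card_porbits_sub (P := mem Ai) hAi) card_edge_perm ?card_sig //.
  exact: edge_perm_sub.
have c3 := card_porbits_sub_compl e Ai.
have h1 u : cut_edges u \in porbit e u.
  by rewrite permE /cut_fun; case: ifP => _; rewrite ?porbit_id ?mem_porbit_next.
have h2 u : u \in Ai -> cut_edges u = u by move=> uA; rewrite permE /cut_fun uA.
have := porbits_refine h1 h2.
by move: c1 c2 c3; lia.
Qed.

(** Let [K] be the sphere minus the interior of the region [A].  Each component
    of the graph left by [cut_edges] borders [A], hence contains a face of the
    cut map that is not in [K]; with [genus_ge0], where the isolated darts of
    the interior cancel out, this bounds the Euler characteristic of [K] by
    the number of edges in [dA].  So the interior of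
    [A] has Euler characteristic at least [2 - #|dA|].  On the other hand its
    faces have at least eight sides and its vertices at least three edges, and
    [1/8 + 1/3 < 1/2] makes each interior edge contribute negatively. *)
Theorem isoperimetry : #|A| <= 28 * #|dA|.
Proof.
have [->|[a0 a0A]] := set_0Vmem A; first by rewrite cards0.
have [s [s1 s2 s3]] := first_return (e * n) Ai.
(* the cut map: edges, faces and vertices are the orbits of a, b and a * b = s *)
pose a := cut_edges; pose b := a * s.
have ab : a * b = s by rewrite /b mulgA cut_edgesK mul1g.
have aE u : a u = if u \in Ai then u else e u by rewrite permE.
have nAi u : u \notin A -> u \notin Ai by move=> uA; rewrite inE (negPf uA).
have nA u : u \notin A -> n u \notin A.
  by apply: contra; apply: (closedV (P := mem A)).
have bn u : u \notin A -> b u = n u.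
  move=> uA; have uAi := nAi _ uA.
  by rewrite permM aE (negPf uAi) s3 ?permM ?eK // ?interior_edge // nAi ?nA.
have bA u : u \notin A -> b u \notin A by move=> uA; rewrite bn ?nA.
have bA' u : u \in A -> b u \in A.
  by move=> uA; apply: contraLR (uA) => /(closedV (P := predC (mem A)) bA).
have VE : #|[set O in porbits (e * n) | ~~ (O \subset Ai)]| + #|Ai| <= #|porbits s|.
  exact: porbits_refine.
have V3 : #|[set O in porbits (e * n) | O \subset Ai]| * 3 <= #|Ai|.
  exact: leq_card_porbits.
have F8 : #|[set O in porbits n | O \subset A]| * 8 <= #|A|.
  by apply: leq_card_porbits => x /fintype.subsetP/(_ x (porbit_id _ _))/A8.
have VS := card_porbits_sub_compl (e * n) Ai.
have FS := card_porbits_sub_compl n A.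
have BS := card_porbits_sub_compl b A.
have FK : #|[set O in porbits n | ~~ (O \subset A)]| <= #|[set O in porbits b | ~~ (O \subset A)]|.
  apply/subset_leq_card/fintype.subsetP => O; rewrite !inE.
  move=> /andP[/imsetP[z _ ->] /subsetPn[x xz xA]].
  have /eqP zx : porbit n z == porbit n x by rewrite eq_porbit_mem porbit_sym.
  have E : porbit b x = porbit n x.
    apply/setP => y; rewrite -!mem_orbit_porbit (orbit_avoid (c := enum A) (n := n)) ?mem_enum //.
      by move=> u; rewrite !mem_enum; exact: An.
    by move=> u; rewrite mem_enum; exact: bn.
  rewrite zx -E imset_f //; apply/subsetPn; exists x; rewrite ?porbit_id //.
have C1 : ncomp a b <= #|[set O in porbits b | O \subset A]|.
  have meet x : [exists y in A, connect (step a b) x y].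
    apply: contraT => /existsPn h.
    have hA y : connect (step a b) x y -> y \notin A by move=> xy; have := h y; rewrite xy andbT.
    have : connect (step a b) x a0.
      apply: (connect_invariant (P := connect (step a b) x) _ (Hc x a0) (connect0 _ _)).
      move=> u v uv xu; have uA := hA _ xu; apply: connect_trans xu (connect1 _).
      case/orP: uv => /eqP->; rewrite /step; last by rewrite bn // eqxx orbT.
      by rewrite aE (negPf (nAi _ uA)) eqxx.
    by move/hA; rewrite a0A.
  have ss := @step_sym _ a b.
  pose f x := odflt x [pick y in A | connect (step a b) x y].
  have fP x : (f x \in A) /\ connect (step a b) x (f x).
    rewrite /f; case: pickP => [y /andP[] //|h0].
    by have /existsP[y] := meet x; rewrite h0.
  rewrite /ncomp -(card_in_imset (f := fun x => porbit b (f x)) (D := roots (step a b))).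
    apply/subset_leq_card/fintype.subsetP => _ /imsetP[x _ ->].
    rewrite inE imset_f //; apply: porbit_sub (fP x).1; exact: bA'.
  move=> u v /eqP ru /eqP rv /eqP; rewrite eq_porbit_mem => uv.
  rewrite -ru -rv; apply/eqP; rewrite root_connect //.
  apply: connect_trans (fP u).2 _; rewrite ss; apply: connect_trans (fP v).2 _.
  exact: porbit_connectr.
have C2 : #|[set O in porbits b | O \subset A]| <= #|A|.
  have := @leq_card_porbits _ b A 1; rewrite muln1; apply=> x _.
  by rewrite lt0n card_porbit_neq0.
have cA : #|A| = #|Ai| + #|dA|.
  rewrite -(cardsID [set d | e d \in A] A).
  by congr (_ + _); apply: eq_card => u; rewrite !inE // andbC.
have := genus_ge0 a b; rewrite ab.
have := card_cut_edges; rewrite -/a.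
have c1 := card_edge_perm He.
move: Hp; lia.
Qed.

End Isoperimetry.

(** * Reduced diagrams over the surface presentation *)

Lemma rot_uniq_head (S : eqType) (s : seq S) i x u :
  uniq s -> rot i s = x :: u -> rot i s = rot (index x s) s.
Proof.
move=> us E; have [le|lt] := leqP (size s) i.
  rewrite rot_oversize // in E *; rewrite E /= eqxx rot0 //.
have ii : index (nth x s i) s = i by rewrite index_uniq.
have := rot_index (mem_nth x lt); rewrite ii E => -[xn _].
by rewrite -xn in ii; rewrite ii.
Qed.

Section Surface.
Variable g : nat.
Hypothesis hg : 2 <= g.
Let P := surface_presentation g.

Definition surface_block (i : 'I_g) : word P :=
  [:: (inl i, false); (inr i, false); (inl i, true); (inr i, true)].

Definition surface_relator : word P := flatten [seq surface_block i | i <- enum 'I_g].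

Lemma relators_surface : relators P = [:: surface_relator].
Proof. by []. Qed.

Lemma size_surface_relator : size surface_relator = (4 * g)%N.
Proof.
rewrite size_flatten /shape -map_comp -[in RHS](size_enum_ord g).
by elim: (enum _) => //= i s ->; rewrite mulnS.
Qed.

Definition letter_index (x : letter P) : 'I_g := match x.1 with inl i => i | inr i => i end.

Lemma uniq_surface_relator : uniq surface_relator.
Proof.
rewrite /surface_relator; elim: (enum _) (enum_uniq 'I_g) => // i s IH /= /andP[is_ us].
have li x : x \in flatten [seq surface_block i | i <- s] -> letter_index x \in s.
  by case/flatten_mapP => j js; rewrite !inE => /or4P[] /eqP->.
have ni x : letter_index x = i -> x \notin flatten [seq surface_block i | i <- s].
  by move=> xi; apply: contra is_ => /li; rewrite xi.
by rewrite !inE !negb_or !ni //= IH // !xpair_eqE !andbF.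
Qed.

(** A relation between consecutive letters of the cyclic relator that is coarse
    enough to be checked without arithmetic on indices, and still separates the
    relator from its inverse: a letter of type [a] is followed by the letter of
    type [b] with the same index and sign, and a letter of type [b] by one of
    type [a] with the opposite sign. *)
Definition follows (x y : letter P) : bool :=
  match x.1 with
  | inl i => y == (inr i, x.2)
  | inr _ => (if y.1 is inl _ then true else false) && (y.2 == ~~ x.2)
  end.

Lemma cycle_surface_relator : path.cycle follows surface_relator.
Proof.
have h (s : seq 'I_g) j : path follows (inr j, true) (flatten [seq surface_block i | i <- s])
   /\ exists j', last (inr j, true) (flatten [seq surface_block i | i <- s]) = (inr j', true).
  elim: s j => [|i s IH] j; first by split=> //; exists j.
  have [p [j' l]] := IH i; split; last by exists j'.
  by rewrite /= p /follows /= !eqxx.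
rewrite /surface_relator; case: (enum _) => // i s /=.
have [p [j' l]] := h s i.
by rewrite rcons_path p l /follows /= !eqxx.
Qed.

(** A vertex of degree one would make a letter follow its own inverse. *)
Lemma follows_inv x : ~~ follows (linv x) x.
Proof. by case: x => [[i|i] b]; rewrite /follows /= ?xpair_eqE ?andbF. Qed.

(** A vertex of degree two would make the relator contain a subword of length
    two together with its inverse. *)
Lemma follows_inv2 x y : follows (linv x) y -> ~~ follows (linv y) x.
Proof.
case: x => [[i|i] b]; rewrite /follows /=.
  by move/eqP->; rewrite /= negbK; case: b.
by case: y => [[j|j] c] //= /eqP ->; rewrite xpair_eqE; case: b; rewrite /= ?andbF.
Qed.

(** No face reads both the relator and its inverse. *)
Lemma follows_flip x y : follows x y -> ~~ follows (linv y) (linv x).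
Proof.
case: x => [[i|i] b]; rewrite /follows /=.
  by move/eqP->; case: b.
by case: y => [[j|j] c] //= /eqP ->; rewrite xpair_eqE; case: b; rewrite /= ?andbF.
Qed.

Section Diagram.
Variables (D : disk_diagram) (lab : dart D -> letter P).
Hypothesis lc : forall d, lab (drev D d) = linv (lab d).
Hypothesis faces_rel : forall d, d \notin outer_cell D ->
  reads_relator (map lab (fingraph.orbit (dnext D) d)).
Let e := drev D.
Let n := dnext D.

Definition positive d := exists k, map lab (fingraph.orbit n d) = rot k surface_relator.
Definition negative d := exists k, map lab (fingraph.orbit n d) = rot k (winv surface_relator).

Lemma inner_sign d : d \notin outer_cell D -> positive d \/ negative d.
Proof.
move/faces_rel => [r []]; rewrite relators_surface inE => /eqP-> [k [E|E]]; [left|right]; by exists k.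
Qed.

Lemma sign_rot (s : word P) d d' : d' \in fingraph.orbit n d ->
  (exists k, map lab (fingraph.orbit n d) = rot k s) ->
  exists k, map lab (fingraph.orbit n d') = rot k s.
Proof.
have cc := cycle_orbit (@perm_inj _ n) d.
move=> d'd [k E]; have [i ->] := orbit_rot_cycle cc (orbit_uniq _ _) d'd.
by rewrite map_rot E; exact: rot_rot_ex.
Qed.

Lemma next_in_orbit d : n d \in fingraph.orbit n d.
Proof. by rewrite mem_orbit_porbit mem_porbit_next. Qed.

Lemma positive_follows d : positive d -> follows (lab d) (lab (n d)).
Proof.
move=> [k E]; apply: cycle_next (cycle_orbit (@perm_inj _ n) d) (in_orbit n d) _.
by rewrite E rot_cycle cycle_surface_relator.
Qed.

Lemma negative_follows d : negative d -> follows (linv (lab (n d))) (linv (lab d)).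
Proof.
move=> [k E].
apply: (@cycle_next _ _ n lab (fun x y => follows (linv y) (linv x))
  _ _ (cycle_orbit (@perm_inj _ n) d) (in_orbit n d)).
rewrite E rot_cycle /winv rev_cycle cycle_map.
have := cycle_surface_relator; congr is_true; apply: eq_cycle => x y /=.
by rewrite !linvK.
Qed.

Lemma positive_negative d : positive d -> ~ negative d.
Proof. by move=> /positive_follows/follows_flip/negP h /negative_follows. Qed.

(** Every letter occurs once in the relator, so that the letter on a shared edge
    determines the whole labels of both faces. *)
Lemma mirror_label d : positive d -> negative (e d) ->
  rot 1 (map lab (fingraph.orbit n (e d))) = winv (map lab (fingraph.orbit n d)).
Proof.
have orb z : exists q, fingraph.orbit n z = z :: q.
  by rewrite /fingraph.orbit -fingraph.orderSpred /=; eexists.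
have [q E] := orb d; have [q' E'] := orb (e d).
move=> [k pk] [l nl]; apply: (can_inj (@winvK _)); rewrite winvK.
have [m wm] : exists m, winv (rot 1 (map lab (fingraph.orbit n (e d)))) = rot m surface_relator.
  rewrite nl; have [m ->] := rot_rot_ex (winv surface_relator) 1 l.
  rewrite /winv map_rot rev_rot -/(winv _) winvK /rotr; by eexists.
rewrite wm pk.
have hk : rot k surface_relator = lab d :: map lab q by rewrite -pk E.
have hm : rot m surface_relator = lab d :: winv (map lab q').
  by rewrite -wm E' /= rot1_cons /winv map_rcons rev_rcons lc linvK.
by rewrite (rot_uniq_head uniq_surface_relator hk) (rot_uniq_head uniq_surface_relator hm).
Qed.

Definition reduced := forall d, d \notin outer_cell D -> e d \notin outer_cell D ->
  positive d -> ~ negative (e d).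

Lemma minimal_reduced :
  (forall D', van_kampen (map lab (boundary_walk D)) D' -> area D <= area D') -> reduced.
Proof.
move=> mn d dO edO pd nd.
have ned : e d \notin fingraph.orbit n d.
  apply/negP => ed; apply: (positive_negative pd); apply: sign_rot nd.
  by rewrite mem_orbit_porbit porbit_sym -mem_orbit_porbit.
have [D' vk] := cancel_mirror lc faces_rel erefl dO edO ned (mirror_label pd nd).
by rewrite ltnNge mn.
Qed.

(** In a reduced diagram, faces that share an edge have the same sign.  Hence
    all faces around an interior vertex read the relator, or all its inverse,
    and the vertex has degree at least three. *)
Lemma surface_isoperimetry (A : {set dart D}) : reduced ->
  (forall d, d \in A -> n d \in A) -> (forall d, d \in A -> d \notin outer_cell D) ->
  #|A| <= 28 * #|[set d in A | e d \notin A]|.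
Proof.
move=> red An Ao.
have [->|[a0 a0A]] := set_0Vmem A; first by rewrite cards0.
have D0 : 0 < #|dart D| by apply/card_gt0P; exists a0.
apply: isoperimetry => //.
- exact: diagram_edge_perm.
- exact: dart_connected.
- by rewrite (dart_planar D0).
- exact: An.
- move=> d /Ao/faces_rel [r []]; rewrite relators_surface inE => /eqP-> [k E].
  have : size (map lab (fingraph.orbit n d)) = (4 * g)%N.
    by case: E => ->; rewrite size_rot ?size_rev ?size_map size_surface_relator.
  rewrite size_map => so; rewrite (_ : #|porbit _ d| = (4 * g)%N); first by move: hg; lia.
  by rewrite -so -(card_uniqP (orbit_uniq n d)); apply: eq_card => u; rewrite -mem_orbit_porbit.
move=> x /fintype.subsetP sub.
have inn u : u \in porbit (e * n) x -> (u \notin outer_cell D) * (e u \notin outer_cell D).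
  by move/sub; rewrite inE => /andP[/Ao ? /Ao ?].
pose x1 := n (e x); pose x2 := n (e x1).
have x1E : x1 \in porbit (e * n) x by have := mem_porbit_next (e * n) x; rewrite permM.
have x2E : x2 \in porbit (e * n) x by have := porbit_closed x1E; rewrite permM.
have pn d : positive d -> positive (n d) by apply: sign_rot; exact: next_in_orbit.
have nn d : negative d -> negative (n d) by apply: sign_rot; exact: next_in_orbit.
have neq1 u : u \in porbit (e * n) x -> n (e u) != u.
  move=> ux; apply/eqP => E.
  case: (inner_sign (inn _ ux).2) => [/positive_follows|/negative_follows].
    by rewrite -/n -/e E lc; apply/negP/follows_inv.
  by rewrite -/n -/e E lc linvK; apply/negP/follows_inv.
have neq2 : x2 != x.
  apply/eqP => E; have xx := porbit_id (e * n) x.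
  case: (inner_sign (inn _ xx).2) => [px|nx].
    have := positive_follows px; rewrite lc => /follows_inv2/negP; apply.
    case: (inner_sign (inn _ x1E).2) => [/positive_follows|].
      by rewrite -/n -/e -/x2 E lc.
    move=> ng; case: (red x1 (inn _ x1E).1 (inn _ x1E).2 _ ng); exact: pn.
  have := negative_follows nx; rewrite lc linvK => /follows_inv2/negP; apply.
  case: (inner_sign (inn _ x1E).2) => [ps|/negative_follows]; last first.
    by rewrite -/n -/e -/x2 E lc linvK.
  case: (red (e x1) (inn _ x1E).2 _ ps); rewrite /e drevK ?(inn _ x1E).1 //.
  exact: nn.
have u3 : uniq [:: x; x1; x2].
  rewrite /= !inE !negb_or eq_sym neq1 ?porbit_id // eq_sym neq2 eq_sym.
  by rewrite neq1.
apply: (@leq_trans #|[:: x; x1; x2]|); first by rewrite (card_uniqP u3).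
apply/subset_leq_card/fintype.subsetP => u.
by rewrite !inE => /or3P[]/eqP->; rewrite ?porbit_id.
Qed.
End Diagram.
End Surface.

(** * The spectral gap *)

Local Open Scope ring_scope.

Section Spectral.
Variable R : realType.

(** Coarea inequality: both sides are additive when the lowest layer
    [m * 1_S] is removed from [phi], where [S] is the support and [m] the
    minimum of [phi] on it, and on such a layer the claim is the
    isoperimetric inequality. *)
Lemma layer_cake (T : finType) (e n : {perm T}) (B : {set T}) (K : nat) (phi : T -> R) :
  (forall A : {set T}, (forall d, d \in A -> n d \in A) -> [disjoint A & B] ->
     #|A| <= K * #|[set d in A | e d \notin A]|)%N ->
  (forall d, 0 <= phi d) -> (forall d, phi (n d) = phi d) ->
  (forall d, d \in B -> phi d = 0) ->
  \sum_d phi d <= K%:R * \sum_d Num.max (phi d - phi (e d)) 0.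
Proof.
move=> iso; have [k] := ubnP #|[set d | phi d != 0]|; elim: k phi => // k IH phi.
set S := [set d | phi d != 0] => Sk phi0 phin phiB.
have [S0|[d0 d0S]] := set_0Vmem S.
  rewrite big1 => [|d _]; last first.
    by have := in_set0 d; rewrite -S0 inE => /negbT; rewrite negbK => /eqP.
  by rewrite mulr_ge0 // sumr_ge0 // => d _; rewrite le_max lexx orbT.
pose m := phi [arg min_(d < d0 in S) phi d]%O.
have [mS mP] : 0 < m /\ forall d, d \in S -> m <= phi d.
  rewrite /m; case: arg_minP => // d dS h; split=> //.
  by rewrite lt_neqAle phi0 eq_sym andbT; move: dS; rewrite inE.
pose psi d := phi d - m * (d \in S)%:R.
have psi0 d : 0 <= psi d.
  rewrite /psi; have [/mP dS|dS] := boolP (d \in S); first by rewrite mulr1 subr_ge0.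
  by rewrite mulr0 subr0.
have nS d : (n d \in S) = (d \in S) by rewrite !inE phin.
have phiS d : d \notin S -> phi d = 0 by rewrite inE negbK => /eqP.
have {}IH : \sum_d psi d <= K%:R * \sum_d Num.max (psi d - psi (e d)) 0.
  apply: IH => // [|d|d dB]; last 2 first.
  - by rewrite /psi phin nS.
  - by rewrite /psi phiB // inE phiB // eqxx mulr0 subr0.
  rewrite -ltnS; apply: leq_trans Sk; rewrite ltnS; apply: proper_card.
  apply/properP; split.
    apply/fintype.subsetP => d; rewrite !inE; apply: contraNneq => pd.
    by rewrite /psi inE pd eqxx mulr0 subr0.
  have : [arg min_(d < d0 in S) phi d]%O \in S by case: arg_minP.
  set d1 := [arg min_(d < d0 in S) phi d]%O => d1S; exists d1 => //.
  by rewrite inE /psi d1S mulr1 /m subrr eqxx.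
have sE : \sum_d phi d = \sum_d psi d + m * #|S|%:R.
  rewrite -sum1_card natr_sum mulr_sumr [X in _ + X]big_mkcond -big_split /=.
  by apply: eq_bigr => d _; rewrite /psi; case: (d \in S); rewrite ?mulr1 ?mulr0 ?subr0 ?addr0 // subrK.
have dE : \sum_d Num.max (phi d - phi (e d)) 0 =
    \sum_d Num.max (psi d - psi (e d)) 0 + m * #|[set d in S | e d \notin S]|%:R.
  rewrite -sum1_card natr_sum mulr_sumr [X in _ + X]big_mkcond -big_split /=.
  apply: eq_bigr => d _; rewrite inE.
  have := psi0 d; have := psi0 (e d); rewrite /psi.
  have [dS|dS] := boolP (d \in S); have [eS|eS] := boolP (e d \in S) => /=;
    rewrite ?mulr1 ?mulr0 ?subr0 ?addr0 // => h1 h2.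
  - by congr Num.max; ring.
  - by rewrite (phiS _ eS) !subr0 !max_l ?phi0 ?subrK.
  - by rewrite (phiS _ dS) !sub0r !max_r // oppr_le0.
have := iso S; rewrite sE dE mulrDr mulrCA => isoS.
apply: lerD => //; rewrite ler_wpM2l ?(ltW mS) // -natrM ler_nat isoS //.
  by move=> d; rewrite nS.
rewrite disjoint_sym disjoint_subset; apply/fintype.subsetP => d dB.
by rewrite !inE phiB // eqxx.
Qed.

Section Diagram.
Variable D : disk_diagram.
Let e := drev D.
Let n := dnext D.
Variable g : {set dart D} -> R.

(** [g] read on darts and extended by zero to the outer cell.  The Dirichlet
    energy, with its boundary term, becomes a single sum over darts. *)
Definition dart_value (d : dart D) : R := if d \in outer_cell D then 0 else g (porbit n d).
Let G := dart_value.

Lemma outer_porbit d : d \in outer_cell D -> outer_cell D = porbit n d.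
Proof.
rewrite /outer_cell; case: (base D) => [b|]; last by rewrite inE.
by rewrite porbit_sym -eq_porbit_mem => /eqP.
Qed.

Lemma mem_faces d : (porbit n d \in faces D) = (d \notin outer_cell D).
Proof.
rewrite !inE imset_f // andbT; congr (~~ _); apply/eqP/idP => [<-|/outer_porbit ->//].
exact: porbit_id.
Qed.

Lemma face_dart f d : f \in faces D -> (d \notin outer_cell D) && (porbit n d == f) = (d \in f).
Proof.
move=> fF; apply/andP/idP => [[_ /eqP<-]|df]; first exact: porbit_id.
have fE : porbit n d = f.
  move: fF df; rewrite inE => /andP[_ /imsetP[x _ ->]].
  by rewrite -eq_porbit_mem => /eqP.
by rewrite -mem_faces fE.
Qed.

Lemma sum_faces (F : dart D -> R) :
  \sum_(d | d \notin outer_cell D) F d = \sum_(f in faces D) \sum_(d in f) F d.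
Proof.
rewrite (partition_big (porbit n) (mem (faces D))) => [|d]; last by rewrite -mem_faces.
apply: eq_bigr => f fF; apply: eq_bigl => d; exact: face_dart.
Qed.

Lemma value_face f d : f \in faces D -> d \in f -> G d = g f.
Proof.
by move=> fF; rewrite -face_dart // /G /dart_value => /andP[/negPf-> /eqP->].
Qed.

Lemma value_outer d : d \in outer_cell D -> G d = 0.
Proof. by rewrite /G /dart_value => ->. Qed.

Lemma weighted_normE : weighted_norm g = \sum_d G d ^+ 2.
Proof.
rewrite (bigID (mem (outer_cell D))) /= big1 => [|d /value_outer->]; last by rewrite expr0n.
rewrite add0r sum_faces; apply: eq_bigr => f fF.
rewrite (eq_bigr (fun _ => g f ^+ 2)) => [|d df]; last by rewrite (value_face fF df).
by rewrite sumr_const mulr_natl.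
Qed.

Lemma dirichletE : \sum_d (G d - G (e d)) ^+ 2 = 2 * dirichlet g.
Proof.
have bE : \sum_(f in faces D) (boundary_edges f)%:R * g f ^+ 2 =
    \sum_(f in faces D) \sum_(d in f) (e d \in outer_cell D)%:R * g f ^+ 2.
  apply: eq_bigr => f _; rewrite -mulr_suml; congr (_ * _).
  rewrite /boundary_edges -sum1_card natr_sum big_mkcond [RHS]big_mkcond.
  by apply: eq_bigr => d _; rewrite inE; case: (d \in f); case: (_ \in _).
rewrite (bigID (mem (outer_cell D))) /= addrC.
have -> : \sum_(d in outer_cell D) (G d - G (e d)) ^+ 2 =
    \sum_(f in faces D) (boundary_edges f)%:R * g f ^+ 2.
  rewrite bE (reindex_inj (@perm_inj _ e)) /=.
  rewrite (eq_bigr (fun d => G d ^+ 2)) => [|d dO]; last first.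
    by rewrite value_outer // drevK sub0r sqrrN.
  rewrite (bigID (mem (outer_cell D))) /= big1 ?add0r => [|d /andP[_ dO]]; last first.
    by rewrite value_outer // expr0n.
  rewrite (eq_bigl (fun d => (d \notin outer_cell D) && (e d \in outer_cell D))); last first.
    by move=> d; rewrite andbC.
  rewrite big_mkcondr sum_faces; apply: eq_bigr => f fF; apply: eq_bigr => d df.
  by rewrite (value_face fF df); case: (_ \in _); rewrite ?mul1r ?mul0r.
rewrite sum_faces /dirichlet mulrDr mulrA divff ?mul1r; last by rewrite pnatr_eq0.
rewrite [X in _ = _ + X](_ : _ = \sum_(f in faces D) (boundary_edges f)%:R * g f ^+ 2 +
  \sum_(f in faces D) (boundary_edges f)%:R * g f ^+ 2); last by ring.
rewrite addrA; congr (_ + _); rewrite bE -big_split /=; apply: eq_bigr => f fF.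
have -> : \sum_(f' in faces D | f' != f) (shared_edges f f')%:R * (g f - g f') ^+ 2 =
   \sum_(d in f) \sum_(f' in faces D | f' != f) (e d \in f')%:R * (g f - g f') ^+ 2.
  rewrite exchange_big /=; apply: eq_bigr => f' _; rewrite -mulr_suml; congr (_ * _).
  rewrite /shared_edges -sum1_card natr_sum big_mkcond [RHS]big_mkcond.
  by apply: eq_bigr => d _; rewrite inE; case: (d \in f); case: (_ \in _).
rewrite -big_split /=; apply: eq_bigr => d df; rewrite (value_face fF df).
have [eO|eO] := boolP (e d \in outer_cell D).
  rewrite value_outer // subr0 mul1r big1 ?add0r // => f' /andP[f'F _].
  by rewrite -(face_dart _ f'F) eO mul0r.
rewrite mul0r addr0; have eF : porbit n (e d) \in faces D by rewrite mem_faces.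
rewrite (value_face eF (porbit_id _ _)).
have [pf|ne] := eqVneq (porbit n (e d)) f.
  rewrite pf subrr expr0n /= big1 // => f' /andP[f'F f'f].
  have [|_] := boolP (e d \in f'); last by rewrite mul0r.
  by rewrite -face_dart // pf eq_sym (negPf f'f) andbF.
rewrite (bigD1 (porbit n (e d))) ?eF //= porbit_id mul1r big1 ?addr0 // => f'.
move=> /andP[/andP[f'F _] f'e].
have [|_] := boolP (e d \in f'); last by rewrite mul0r.
by rewrite -face_dart // => /andP[_]; rewrite eq_sym (negPf f'e).
Qed.

Lemma sum_rev (F : dart D -> R) : \sum_d F (e d) = \sum_d F d.
Proof. by rewrite [RHS](reindex_inj (@perm_inj _ e)). Qed.

(** Cheeger's inequality: apply [layer_cake] to the square of [g] and split the
    difference of squares by the weighted inequality of arithmetic and geometric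
    means.  The weight [56] makes the term in the norm equal to [28 * 2 / 112],
    one half, which the left-hand side absorbs; there remains
    [2 * 28 * 112 = 6272]. *)
Lemma cheeger :
  (forall A : {set dart D}, (forall d, d \in A -> n d \in A) ->
     (forall d, d \in A -> d \notin outer_cell D) ->
     #|A| <= 28 * #|[set d in A | e d \notin A]|)%N ->
  weighted_norm g <= 6272 * dirichlet g.
Proof.
move=> iso; rewrite weighted_normE.
have Gn d : G (n d) = G d.
  rewrite /G /dart_value mem_outer_next; case: ifP => // _; congr g.
  by apply/eqP; rewrite eq_porbit_mem porbit_closed ?porbit_id.
have cake : \sum_d G d ^+ 2 <=
    28%:R * \sum_d Num.max (G d ^+ 2 - G (e d) ^+ 2) 0.
  apply: (@layer_cake _ e n (outer_cell D)).
  - move=> A An; rewrite disjoint_subset => /fintype.subsetP AO; apply: iso => //.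
  - by move=> d; exact: sqr_ge0.
  - by move=> d; rewrite Gn.
  - by move=> d /value_outer->; rewrite expr0n.
have pt d : Num.max (G d ^+ 2 - G (e d) ^+ 2) 0 <=
    56 * (G d - G (e d)) ^+ 2 + 112^-1 * (G d ^+ 2 + G (e d) ^+ 2).
  set x := G d; set y := G (e d).
  have h0 := sqr_ge0 (x - y); have h1 := sqr_ge0 x; have h2 := sqr_ge0 y.
  rewrite ge_max; apply/andP; split; last by lra.
  (* 112 (x - y) - (x + y) *)
  have h3 := sqr_ge0 (111 * x - 113 * y).
  have : 224 * (56 * (x - y) ^+ 2 + 112^-1 * (x ^+ 2 + y ^+ 2) - (x ^+ 2 - y ^+ 2)) =
     (111 * x - 113 * y) ^+ 2 + (x - y) ^+ 2 by field.
  lra.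
have : \sum_d Num.max (G d ^+ 2 - G (e d) ^+ 2) 0 <=
    56 * (2 * dirichlet g) + 112^-1 * (2 * \sum_d G d ^+ 2).
  apply: (le_trans (ler_sum _ (fun d _ => pt d))).
  rewrite big_split /= -!mulr_sumr dirichletE big_split /= (sum_rev (fun d => G d ^+ 2)).
  lra.
move: cake; lra.
Qed.

Lemma weighted_norm_gt0 f : f \in faces D -> g f != 0 -> 0 < weighted_norm g.
Proof.
move=> fF gf; rewrite /weighted_norm (bigD1 f) //=.
apply: ltr_wpDr; first by apply: sumr_ge0 => f' _; rewrite mulr_ge0 ?sqr_ge0.
apply: mulr_gt0; last by rewrite exprn_even_gt0.
by move: fF; rewrite inE ltr0n lt0n => /andP[_ /imsetP[x _ ->]]; exact: card_porbit_neq0.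
Qed.

(** The cross terms [- 2 * G d * G (e d)] are nonpositive. *)
Lemma dirichlet_indicator_le :
  (forall f, g f = 0 \/ g f = 1) -> dirichlet g <= weighted_norm g.
Proof.
move=> g01; rewrite weighted_normE -(@ler_pM2l _ 2) // -dirichletE.
rewrite mulr_natl mulr2n -{2}(sum_rev (fun d => G d ^+ 2)) -big_split /=.
apply: ler_sum => d _; have G0 u : 0 <= G u.
  by rewrite /G /dart_value; case: ifP => // _; case: (g01 (porbit n u)) => ->.
have := mulr_ge0 (G0 d) (G0 (e d)); rewrite sqrrB; lra.
Qed.

End Diagram.

Lemma mu1_le1 (D : disk_diagram) f : f \in faces D -> (mu1 R D <= 1)%E.
Proof.
move=> fF; pose g f' : R := (f' == f)%:R.
have gf : g f != 0 by rewrite /g eqxx oner_neq0.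
apply: (@le_trans _ _ (dirichlet g / weighted_norm g)%:E).
  by apply: ereal_inf_lbound; exists g; split=> //; exists f.
rewrite lee_fin ler_pdivrMr ?(weighted_norm_gt0 fF gf) // mul1r.
by apply: dirichlet_indicator_le => f'; rewrite /g; case: (f' == f); [right|left].
Qed.

Lemma mu1_ge (D : disk_diagram) :
  (forall A : {set dart D}, (forall d, d \in A -> dnext D d \in A) ->
     (forall d, d \in A -> d \notin outer_cell D) ->
     #|A| <= 28 * #|[set d in A | drev D d \notin A]|)%N ->
  ((6272^-1 : R)%:E <= mu1 R D)%E.
Proof.
move=> iso; apply: le_ereal_inf_tmp => _ [g [[f fF gf] ->]].
rewrite lee_fin ler_pdivlMr ?(weighted_norm_gt0 fF gf) //.
by have := @cheeger D g iso; lra.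
Qed.

Lemma mu1_no_face (D : disk_diagram) : area D = 0%N -> mu1 R D = +oo%E.
Proof.
move/eqP; rewrite cards_eq0 => /eqP D0.
rewrite /mu1 (_ : mkset _ = classical_sets.set0) ?ereal_inf0 //.
by rewrite -classical_sets.subset0 => a [g [[f]]]; rewrite D0 inE.
Qed.
End Spectral.

(** * Diagrams of minimal area *)

Section Minimal.
Local Open Scope nat_scope.
Local Open Scope group_scope.

(** Without inner faces the diagram is a tree, with more vertices than edges.
    It has a leaf, around which the boundary word backtracks. *)
Lemma has_face (P : presentation) (w : word P) D :
  van_kampen w D -> cyclically_reduced w -> w != [::] -> 0 < area D.
Proof.
case=> lab [lc _ <-] cr w0; rewrite lt0n; apply/negP => /eqP D0.
move: cr w0; rewrite /boundary_walk; case bE: (base D) => [b|//] cr _.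
have T0 : 0 < #|dart D| by rewrite -base_dart bE.
have F1 := card_porbits_diagram T0; rewrite D0 in F1.
have onlyf d : d \in fingraph.orbit (dnext D) b.
  rewrite mem_orbit_porbit -eq_porbit_mem; apply/eqP.
  have /cards1P[X XE] : #|porbits (dnext D)| == 1%N by rewrite F1.
  have inP z : porbit (dnext D) z \in [set X] by rewrite -XE imset_f.
  by rewrite (set1P (inP d)) (set1P (inP b)).
have E2 := card_edge_perm (@diagram_edge_perm D).
have [x /eqP leaf] : exists x, (drev D * dnext D) x == x.
  apply/existsP; apply: contraT => /existsPn h.
  have h2 x : porbit (drev D * dnext D) x \subset [set: dart D] ->
      1 < #|porbit (drev D * dnext D) x|.
    move=> _; apply: (@leq_trans #|[set x; (drev D * dnext D) x]|).
      by rewrite cards2 eq_sym h.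
    by apply/subset_leq_card; rewrite subUset !sub1set porbit_id mem_porbit_next.
  have := leq_card_porbits h2; rewrite cardsT.
  have -> : [set O in porbits (drev D * dnext D) | O \subset [set: dart D]] =
      porbits (drev D * dnext D).
    by apply/setP => O; rewrite inE finset.subsetT andbT.
  by have := dart_planar T0; lia.
rewrite permM in leaf.
have := cycle_next (cycle_orbit (@perm_inj _ (dnext D)) b) (onlyf (drev D x)) cr.
by rewrite leaf lc linvK eqxx.
Qed.

Lemma minimal_diagram (P : presentation) (w : word P) D :
  van_kampen w D -> exists D0, van_kampen w D0 /\
    forall D', van_kampen w D' -> area D0 <= area D'.
Proof.
have [k] := ubnP (area D); elim: k D => // k IH D Dk vk.
have [[D' [vk' lt]]|nex] := pselect (exists D', van_kampen w D' /\ area D' < area D).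
  exact: IH D' (leq_trans lt Dk) vk'.
exists D; split=> // D' vk'; rewrite leqNgt; apply/negP => lt.
by apply: nex; exists D'.
Qed.
End Minimal.

(** * The Dehn function and the spectral profile *)

Local Open Scope ring_scope.
Local Open Scope ereal_scope.

Section Profile.
Variable R : realType.

Lemma area_min_le (P : presentation) (w : word P) D :
  van_kampen w D -> area_min R w <= (area D)%:R%:E.
Proof. by move=> vk; apply: ereal_inf_lbound; exists D. Qed.

Lemma area_min_ge0 (P : presentation) (w : word P) : 0 <= area_min R w.
Proof. by apply: le_ereal_inf_tmp => _ [D [_ ->]]; rewrite lee_fin. Qed.

Lemma area_minimisingP (P : presentation) (w : word P) D :
  area_minimising R w D <->
  van_kampen w D /\ forall D', van_kampen w D' -> (area D <= area D')%N.
Proof.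
split=> [[vk E]|[vk mn]]; split=> //.
  by move=> D' /area_min_le; rewrite -E lee_fin ler_nat.
apply/eqP; rewrite eq_le area_min_le // andbT.
by apply: le_ereal_inf_tmp => _ [D' [vk' ->]]; rewrite lee_fin ler_nat mn.
Qed.

Lemma dehn_ge0 (P : presentation) n : 0 <= dehn R P n.
Proof.
apply: (le_trans (area_min_ge0 [::])); apply: ereal_sup_ubound; exists [::]; split=> //.
exact: group_eq_refl.
Qed.

(** The summand [C n + C] of the comparison makes one direction hold for every
    presentation. *)
Lemma linear_dehn_class_of (P : presentation) (K : nat) :
  (forall w : word P, null_homotopic w -> cyclically_reduced w ->
     exists2 D, van_kampen w D & (area D <= K * size w)%N) ->
  linear_dehn_class R P.
Proof.
move=> h; split.
  exists K.+1 => // n; apply: ge_ereal_sup => _ [w [nw cw wn ->]].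
  have [D vk le] := h w nw cw.
  apply: (le_trans (area_min_le vk)).
  apply: (@le_trans _ _ (K.+1 * n + K.+1)%N%:R%:E); last first.
    by rewrite leeDr // mule_ge0 // lee_fin.
  rewrite lee_fin ler_nat; apply: (leq_trans le); nia.
exists 1%N => // n; rewrite !mul1n; apply: (@le_trans _ _ (n + 1)%N%:R%:E).
  by rewrite lee_fin ler_nat leq_addr.
by rewrite leeDr // mule_ge0 ?dehn_ge0 // lee_fin.
Qed.

(** There is no relator for a face to read. *)
Lemma free_no_face r (w : word (free_presentation r)) D : van_kampen w D -> area D = 0%N.
Proof.
case=> lab [_ rel _]; apply/eqP; rewrite cards_eq0; apply/eqP/setP => f.
rewrite [RHS]inE; apply/negP => fF.
have /imsetP[d _ fE] : f \in porbits (dnext D) by move: fF; rewrite inE => /andP[].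
have dO : d \notin outer_cell D by rewrite -mem_faces -fE.
by have [s []] := rel d dO.
Qed.

Section Surface.
Variable g : nat.
Hypothesis hg : (2 <= g)%N.
Let P := surface_presentation g.

Lemma minimal_isoperimetry (w : word P) D : van_kampen w D ->
  (forall D', van_kampen w D' -> (area D <= area D')%N) ->
  forall A : {set dart D}, (forall d, d \in A -> dnext D d \in A) ->
     (forall d, d \in A -> d \notin outer_cell D) ->
     (#|A| <= 28 * #|[set d in A | drev D d \notin A]|)%N.
Proof.
case=> lab [lc rel bw] mn A An AO.
apply: (surface_isoperimetry hg lc rel) => //.
by apply: (minimal_reduced lc rel); rewrite bw.
Qed.

Lemma card_outer (P' : presentation) (w : word P') D :
  van_kampen w D -> (#|outer_cell D| <= size w)%N.
Proof.
case=> lab [_ _ <-]; rewrite size_map /boundary_walk /outer_cell.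
case: (base D) => [b|]; last by rewrite cards0.
rewrite -(card_uniqP (orbit_uniq (dnext D) b)); apply/subset_leq_card/fintype.subsetP => u.
by rewrite mem_orbit_porbit.
Qed.

Lemma minimal_area (w : word P) D : van_kampen w D ->
  (forall D', van_kampen w D' -> (area D <= area D')%N) -> (area D <= 28 * size w)%N.
Proof.
move=> vk mn; pose A := finset.setC (outer_cell D).
have Ao d : d \in A -> d \notin outer_cell D by rewrite inE.
have An d : d \in A -> dnext D d \in A.
  by rewrite !inE mem_outer_next.
have iso := minimal_isoperimetry vk mn An Ao.
apply: (@leq_trans #|A|); last first.
  apply: (leq_trans iso); rewrite leq_mul2l /=.
  apply: leq_trans (card_outer vk).
  rewrite -(card_imset _ (@perm_inj _ (drev D))); apply/subset_leq_card.
  by apply/fintype.subsetP => _ /imsetP[d + ->]; rewrite !inE negbK => /andP[].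
apply: leq_trans (_ : #|[set O in porbits (dnext D) | O \subset A]| <= _)%N.
  apply/subset_leq_card/fintype.subsetP => f fF; rewrite inE; apply/andP; split.
    by move: fF; rewrite inE => /andP[].
  by apply/fintype.subsetP => d df; rewrite inE; move: df; rewrite -face_dart // => /andP[].
rewrite -[leqLHS]muln1; apply: leq_card_porbits => x _.
by rewrite lt0n card_porbit_neq0.
Qed.

Lemma surface_relator_null : null_homotopic (surface_relator g : word P).
Proof.
have := @group_eq_relator P [::] (surface_relator g) [::]; rewrite cats0; apply.
by rewrite relators_surface mem_head.
Qed.

Lemma surface_relator_reduced : cyclically_reduced (surface_relator g : word P).
Proof.
apply: sub_cycle (cycle_surface_relator g) => x y.
by case: x => [[i|i] b]; rewrite /follows /=; [move/eqP->|case: y => [[j|j] c]].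
Qed.

Lemma Lambda_star_surface_le n : (4 * g <= n)%N -> Lambda_star R P n <= 1.
Proof.
move=> gn; have [D1 vk1] := van_kampen_exists surface_relator_null.
have [D [vk mn]] := minimal_diagram vk1.
have D0 : (0 < area D)%N.
  apply: has_face vk surface_relator_reduced _; rewrite -size_eq0 size_surface_relator.
  by move: hg; lia.
have [f fF] : exists f, f \in faces D by apply/card_gt0P.
apply: le_trans (mu1_le1 R fF); apply: ereal_inf_lbound.
exists (surface_relator g), D; split=> //.
- exact: surface_relator_null.
- exact: surface_relator_reduced.
- exact/area_minimisingP.
- case: vk => lab [_ _ bw]; rewrite /perimeter -(size_map lab) bw.
  by rewrite size_surface_relator.
Qed.

Lemma Lambda_star_surface_ge n : (6272^-1 : R)%:E <= Lambda_star R P n.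
Proof.
apply: le_ereal_inf_tmp => _ [w [D [_ _ /area_minimisingP[vk mn] _ ->]]].
exact/mu1_ge/minimal_isoperimetry/mn.
Qed.
End Surface.
End Profile.

Local Close Scope ereal_scope.

Theorem theorem5p9 (R : realType) (r g : nat)
    (hr : (2 <= r)%N) (hg : (2 <= g)%N) :
  linear_dehn_class R (free_presentation r) /\
  linear_dehn_class R (surface_presentation g) /\
  (forall n : nat, (1 <= n)%N ->
     Lambda_star R (free_presentation r) n = +oo%E) /\
  profile_asymp (Lambda_star R (surface_presentation g)) (fun _ => 1%E).
Proof.
split; last split; last split.
- apply: (@linear_dehn_class_of R _ 0) => w /van_kampen_exists[D vk] _.
  by exists D => //; rewrite (free_no_face vk).
- apply: (@linear_dehn_class_of R _ 28) => w /van_kampen_exists[D1 vk1] _.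
  have [D [vk mn]] := minimal_diagram vk1.
  by exists D => //; exact: minimal_area vk mn.
- move=> n _; apply/eqP; rewrite eq_le leey /=.
  apply: le_ereal_inf_tmp => _ [w [D [_ _ [vk _] _ ->]]].
  by rewrite mu1_no_face // (free_no_face vk).
split.
  exists (4 * g)%:R; first by rewrite ler1n; lia.
  move=> n n1; rewrite mule1.
  apply: (@le_trans _ _ 1%E); last by rewrite lee_fin ler1n; lia.
  apply: Lambda_star_surface_le => //.
  rewrite -natrM -[(_ * _)%:R]/((Posz (4 * g * n))%:~R) intrKceil absz_nat.
  by rewrite leq_pmulr.
have [c [c0 c1 cE]] : exists c : R, [/\ 0 < c, 1 <= c & c = 6272] 
  by exists 6272; split; [lra|lra|reflexivity].
exists c => // n _; apply: (@le_trans _ _ (c%:E * (c^-1)%:E)%E).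
  by rewrite -EFinM divff ?gt_eqF.
apply: lee_pmul => //; rewrite ?lee_fin ?invr_ge0 ?(ltW c0) //.
by rewrite cE; exact: Lambda_star_surface_ge.
Qed.
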